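(* Let $D_1$ and $D_2$ be distinct generic curves in $\mathbb{P}^2(K)$. If $\deg D_1+\deg D_2\ge 4$, then $\mathbb{P}^2(K)\setminus(D_1\cup D_2)$ is $K$-hyperbolic.
   Context: $K$ is an algebraically closed field of arbitrary characteristic, complete with respect to a non-archimedean absolute value $|\cdot|$. A $K$-analytic function on $K$ is a function given by a power series with coefficients in $K$ converging on all of $K$. An analytic map $f:K\to\mathbb{P}^2(K)$ is a map $f=[f_0:f_1:f_2]$ where $f_0,f_1,f_2$ are $K$-analytic functions on $K$ with no common zero. An analytic map from $K$ to a subset $Y\subset\mathbb{P}^2(K)$ is such a map with image contained in $Y$. A variety $Y$ over $K$ is $K$-hyperbolic if every analytic map from $K$ to $Y$ is constant. ''Generic'' has its usual meaning: for fixed degrees $d_1,d_2\ge 1$, identify plane curves of degree $d_i$ with points of the projective space $\mathbb{P}^{M_i}(K)$, $M_i=\binom{d_i+2}{2}-1$, of nonzero homogeneous polynomials of degree $d_i$ in three variables up to scaling; a statement holds for generic curves $D_1,D_2$ of degrees $d_1,d_2$ if it holds for all pairs $(D_1,D_2)$ in some nonempty Zariski-open subset of $\mathbb{P}^{M_1}(K)\times\mathbb{P}^{M_2}(K)$. *)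

(* Defs.v *)
From HB Require Import structures.
From mathcomp Require Import all_boot all_order all_algebra.
(* mpoly has to be imported before the analysis files: in the other order its
   notations clash with theirs. *)
From mathcomp Require Import mpoly.
From mathcomp Require Import boolp classical_sets reals topology normedtype.

Set Implicit Arguments.
Unset Strict Implicit.
Unset Printing Implicit Defensive.

Import Order.TTheory GRing.Theory Num.Theory.
Import numFieldNormedType.Exports.

Local Open Scope classical_set_scope.
Local Open Scope ring_scope.

(* The trivial absolute value is allowed. *)
Record nonarch_absolute_value (R : realType) (K : fieldType) (v : K -> R)
    : Prop := NonarchAbsoluteValue {
  absv_ge0 : forall x, 0 <= v x;
  absv_eq0 : forall x, v x = 0 <-> x = 0;
  absvM : forall x y, v (x * y) = v x * v y;
  absv_ultra : forall x y, v (x + y) <= Num.max (v x) (v y) }.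

Definition absv_cvg (R : realType) (K : fieldType) (v : K -> R)
    (u : nat -> K) (l : K) : Prop :=
  (fun n => v (u n - l)) @ \oo --> (0 : R).

Definition absv_cauchy (R : realType) (K : fieldType) (v : K -> R)
    (u : nat -> K) : Prop :=
  forall e : R, 0 < e ->
    exists N, forall m n, (N <= m)%N -> (N <= n)%N -> v (u m - u n) < e.

Definition absv_complete (R : realType) (K : fieldType) (v : K -> R) : Prop :=
  forall u : nat -> K, absv_cauchy v u -> exists l, absv_cvg v u l.

Definition analytic_function (R : realType) (K : fieldType) (v : K -> R)
    (g : K -> K) : Prop :=
  exists a : nat -> K,
    forall z, absv_cvg v (fun n => \sum_(i < n) a i * z ^+ i) (g z).

(* The projective space of lines through the origin of V; a nonzero vector x
   represents the point <[x]>. *)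
Definition proj (K : fieldType) (V : vectType K) : Type :=
  {L : {vspace V} | \dim L == 1%N}.

Definition P2 (K : fieldType) : Type := proj 'rV[K]_3.

(* Plane curves of degree d: nonzero forms of degree d up to scaling, that is
   the points of P^M with M + 1 = dim (dhomog 3 K d) = 'C(d + 2, d). *)
Definition curve (K : fieldType) (d : nat) : Type := proj (dhomog 3 K d).

Definition curve_forms (K : fieldType) (d : nat) (D : curve K d)
    : set {mpoly K[3]} :=
  [set F | exists2 G : dhomog 3 K d, G \in sval D & F = val G].

Definition curve_points (K : fieldType) (d : nat) (D : curve K d)
    : set (P2 K) :=
  [set p : P2 K | forall (F : {mpoly K[3]}) (x : 'rV[K]_3),
     curve_forms D F -> x \in sval p -> F.@[x 0] = 0].

Definition analytic_map (R : realType) (K : fieldType) (v : K -> R)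
    (f : K -> P2 K) : Prop :=
  exists F : 'I_3 -> K -> K,
    [/\ forall i, analytic_function v (F i),
        forall z, exists i, F i z != 0 &
        forall z, sval (f z) = <[\row_(i < 3) F i z]>%VS].

Definition K_hyperbolic (R : realType) (K : fieldType) (v : K -> R)
    (Y : set (P2 K)) : Prop :=
  forall f : K -> P2 K, analytic_map v f -> (forall z, Y (f z)) ->
    exists p, forall z, f z = p.

Definition monomials3 (d : nat) : pred 'X_{1..3 < d.+1} :=
  fun m => mdeg m == d.
Arguments monomials3 : clear implicits.

Definition form_coef (K : fieldType) (d : nat) (F : dhomog 3 K d)
    : 'I_#|monomials3 d| -> K :=
  fun i => (val F)@_(val (enum_val i)).

Definition bihomogeneous (K : fieldType) (n1 n2 a b : nat)
    (G : {mpoly K[n1 + n2]}) : Prop :=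
  forall m, m \in msupp G ->
    (\sum_(i < n1) m (lshift n2 i))%N = a /\
    (\sum_(j < n2) m (rshift n1 j))%N = b.

(* Zero loci of families of bihomogeneous polynomials in the coefficients of
   the two forms; by bihomogeneity, the vanishing of G does not depend on the
   representatives F1 and F2. *)
Definition zariski_closed (K : fieldType) (d1 d2 : nat)
    (Z : set (curve K d1 * curve K d2)) : Prop :=
  exists S : set {mpoly K[#|monomials3 d1| + #|monomials3 d2|]},
    (forall G, S G -> exists a b, bihomogeneous a b G) /\
    forall D1 D2, Z (D1, D2) <->
      forall G (F1 : dhomog 3 K d1) (F2 : dhomog 3 K d2),
        S G -> F1 \in sval D1 -> F1 != 0 -> F2 \in sval D2 -> F2 != 0 ->
        G.@[fun k => match split k with
                     | inl i => form_coef F1 i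
                     | inr j => form_coef F2 j
                     end] = 0.

Definition zariski_open (K : fieldType) (d1 d2 : nat)
    (U : set (curve K d1 * curve K d2)) : Prop :=
  zariski_closed (~` U).

Definition holds_for_generic_curves (K : fieldType) (d1 d2 : nat)
    (P : curve K d1 -> curve K d2 -> Prop) : Prop :=
  exists U : set (curve K d1 * curve K d2),
    [/\ zariski_open U, U !=set0 & forall D1 D2, U (D1, D2) -> P D1 D2].

(* Main.v *)
Require Import Defs.
From HB Require Import structures.
From mathcomp Require Import all_boot all_order all_algebra.
From mathcomp Require Import mpoly.
From mathcomp Require Import boolp classical_sets reals topology normedtype.
From mathcomp Require Import ring lra zify.

Set Implicit Arguments.
Unset Strict Implicit.
Unset Printing Implicit Defensive.

Import Order.TTheory GRing.Theory Num.Theory.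
Import numFieldNormedType.Exports.

Local Open Scope classical_set_scope.
Local Open Scope ring_scope.

(** Write [f = [f0 : f1 : f2]] and let F1, F2 be forms that define the curves.
    If f avoids both curves, then F1(f) and F2(f) are entire functions without
    zeros. Over a complete algebraically closed non-archimedean field such a
    function is constant ([zero_free_constant]), so F1(f) = c1 and F2(f) = c2.

    Suppose that f is not constant and let X be the largest Gauss norm of the
    f_i on the circle of radius r. As r grows, the bounded values c1, c2 become
    negligible against X^d, so that f is asymptotically proportional to a common
    zero a of F1 and F2; there are finitely many candidates, and one of them
    serves a sequence of radii going to infinity. Normalize a by a_z = 1 and put
    y = f - f_z a. To first order F_i(f) = f_z^(d_i - 1) (dF_i(a), y), and the
    two linear forms dF_i(a) are independent when the curves meet transversally
    at a; hence y is bounded ([near_curve_asymptote]), and constant by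
    Liouville's argument ([asymptotic_line]). Thus f = f_z a + y. Since f_z is
    onto K, each F_i is constant on the line of all t a + y; if y <> 0 this says
    that a line of the plane meets each curve D_i at a alone. When d1, d2 >= 2
    that line would be tangent to both curves at a, against transversality. When
    one degree is 1 the other is at least 3, and the line would be a tangent of
    the second curve with contact of order >= 3, that is, a would be a flex.
    So for curves that meet transversally, away from the line z = 0, and not at
    flexes of one when the other is a line, y = 0 and f is constant
    ([generic_pair_hyperbolic]). No derivative of f is taken, so that the
    argument is the same in every characteristic.

    All these conditions say that F1, F2 and a third form built from them have
    no common zero. They are used in the form [generic_pair]: in some degree
    every monomial lies in the ideal of the three forms. This is convenient
    twice. It can be evaluated on f, which turns it into inequalities between
    Gauss norms, and it reduces multiplication by x and y on the quotient by
    (F1, F2) to multiplication by z times a scalar matrix, so that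
    Cayley-Hamilton provides the finitely many candidates a
    ([asymptotic_factor]). And it is the surjectivity of a linear map whose
    matrix depends polynomially on the coefficients of F1 and F2, so that it
    holds where a bihomogeneous minor does not vanish ([generic_pair_open]);
    an explicit pair ([generic_pair_exists]) shows that this open set is not
    empty. *)

(** * Ultrametric norms and Gauss norms *)

Record ultranorm (R : realType) (E : comNzRingType) (w : E -> R) : Prop :=
  Ultranorm {
  ultra_ge0 : forall x, 0 <= w x;
  ultra_eq0 : forall x, w x = 0 <-> x = 0;
  ultraM : forall x y, w (x * y) = w x * w y;
  ultraD : forall x y, w (x + y) <= Num.max (w x) (w y) }.

Section UltranormTheory.
Context (R : realType) (E : comNzRingType) (w : E -> R) (hw : ultranorm w).

Lemma ultra0 : w 0 = 0. Proof. exact/(ultra_eq0 hw). Qed.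

Lemma ultra_gt0 x : x != 0 -> 0 < w x.
Proof.
move=> x0; rewrite lt_neqAle ultra_ge0 // andbT eq_sym.
by apply: contra x0 => /eqP /(ultra_eq0 hw) ->.
Qed.

Lemma ultra1 : w 1 = 1.
Proof.
have h : w 1 != 0 by apply: lt0r_neq0; apply: ultra_gt0; exact: oner_neq0.
by apply: (mulfI h); rewrite -(ultraM hw) !mulr1.
Qed.

Lemma ultraX x n : w (x ^+ n) = w x ^+ n.
Proof. by elim: n => [|n IH]; rewrite ?expr0 ?ultra1 // !exprS ultraM // IH. Qed.

Lemma ultra_prod (I : Type) (s : seq I) (P : pred I) (F : I -> E) :
  w (\prod_(i <- s | P i) F i) = \prod_(i <- s | P i) w (F i).
Proof. exact: (big_morph w (ultraM hw) ultra1). Qed.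

Lemma ultraN x : w (- x) = w x.
Proof.
have : w (-1) ^+ 2 == 1 by rewrite -ultraX sqrrN expr1n ultra1.
rewrite sqrf_eq1 => /orP[/eqP h|/eqP h]; first by rewrite -mulN1r ultraM // h mul1r.
by have := ultra_ge0 hw (-1); rewrite h; lra.
Qed.

Lemma ultraBC x y : w (x - y) = w (y - x).
Proof. by rewrite -ultraN opprB. Qed.

Lemma ultraD_le x y c : w x <= c -> w y <= c -> w (x + y) <= c.
Proof. by move=> hx hy; apply: le_trans (ultraD hw _ _) _; rewrite ge_max hx. Qed.

Lemma ultraB_le x y c : w x <= c -> w y <= c -> w (x - y) <= c.
Proof. by move=> hx hy; apply: ultraD_le => //; rewrite ultraN. Qed.

Lemma ultraD_lt x y c : w x < c -> w y < c -> w (x + y) < c.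
Proof. by move=> hx hy; apply: le_lt_trans (ultraD hw _ _) _; rewrite gt_max hx. Qed.

Lemma ultraB_lt x y c : w x < c -> w y < c -> w (x - y) < c.
Proof. by move=> hx hy; apply: ultraD_lt => //; rewrite ultraN. Qed.

Lemma ultra_sum_le (I : Type) (s : seq I) (P : pred I) (F : I -> E) c :
  0 <= c -> (forall i, P i -> w (F i) <= c) -> w (\sum_(i <- s | P i) F i) <= c.
Proof.
move=> c0 h; elim/big_rec: _ => [|i x Pi hx]; first by rewrite ultra0.
exact: ultraD_le (h i Pi) hx.
Qed.

Lemma ultra_sum_lt (I : Type) (s : seq I) (P : pred I) (F : I -> E) c :
  0 < c -> (forall i, P i -> w (F i) < c) -> w (\sum_(i <- s | P i) F i) < c.
Proof.
move=> c0 h; elim/big_rec: _ => [|i x Pi hx]; first by rewrite ultra0.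
exact: ultraD_lt (h i Pi) hx.
Qed.

(** The isosceles triangle principle. *)
Lemma ultraD_eq x y : w y < w x -> w (x + y) = w x.
Proof.
move=> h; apply/eqP; rewrite eq_le; apply/andP; split.
  by apply: ultraD_le => //; exact: ltW.
rewrite leNgt; apply/negP => h'.
by have := ultraB_lt h' h; rewrite addrK ltxx.
Qed.

End UltranormTheory.

Lemma absv_ultranorm (R : realType) (K : fieldType) (v : K -> R) :
  nonarch_absolute_value v -> ultranorm v.
Proof. by case. Qed.

(** The supremum of the absolute value of p on the disc of radius r in a large
    enough extension. Defining it through the coefficients works for every real
    r and for the trivial absolute value. The coefficients are taken in any
    normed ring because the construction is iterated in [taylor_estimate]. *)
Definition gauss_norm (R : realType) (E : comNzRingType) (w : E -> R) (r : R)
    (p : {poly E}) : R :=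
  \big[Num.max/0]_(i < size p) (w p`_i * r ^+ i).

Section GaussNorm.
Context (R : realType) (E : comNzRingType) (w : E -> R) (hw : ultranorm w).
Context (r : R) (r0 : 0 < r).
Local Notation gn := (gauss_norm w r).
Implicit Types (p q : {poly E}).

Lemma gauss_term_ge0 x i : 0 <= w x * r ^+ i.
Proof. exact: mulr_ge0 (ultra_ge0 hw _) (exprn_ge0 _ (ltW r0)). Qed.

Lemma gauss_norm_ge0 p : 0 <= gn p.
Proof. exact: bigmax_ge_id. Qed.

Lemma coef_le_gauss_norm p i : w p`_i * r ^+ i <= gn p.
Proof.
case: (ltnP i (size p)) => h; last first.
  by rewrite nth_default // ultra0 // mul0r gauss_norm_ge0.
exact: (le_bigmax _ (fun j : 'I_(size p) => w p`_j * r ^+ j) (Ordinal h)).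
Qed.

Lemma gauss_norm_le p c :
  0 <= c -> (forall i, w p`_i * r ^+ i <= c) -> gn p <= c.
Proof. by move=> c0 h; apply: bigmax_le. Qed.

Lemma gauss_norm_lt p c :
  0 < c -> (forall i, w p`_i * r ^+ i < c) -> gn p < c.
Proof. by move=> c0 h; apply: bigmax_lt. Qed.

(** The first index is the one that matters in [gauss_normM]: it makes the
    maximal term of the corresponding coefficient of a product unique. *)
Lemma gauss_norm_attained p : p != 0 -> exists i,
  gn p = w p`_i * r ^+ i /\ forall j, (j < i)%N -> w p`_j * r ^+ j < gn p.
Proof.
move=> p0.
have ex : exists i, w p`_i * r ^+ i == gn p.
  apply: contrapT => h.
  have g0 : 0 < gn p.
    apply: lt_le_trans (coef_le_gauss_norm p (size p).-1).
    by rewrite mulr_gt0 ?exprn_gt0 // ultra_gt0 // -lead_coefE lead_coef_eq0.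
  suff : gn p < gn p by rewrite ltxx.
  apply: (@gauss_norm_lt p (gn p)) => // i; rewrite lt_neqAle coef_le_gauss_norm andbT.
  by apply/negP => hi; apply: h; exists i.
case: (ex_minnP ex) => i /eqP hi hmin; exists i; split=> // j ji.
rewrite lt_neqAle coef_le_gauss_norm andbT; apply/negP => hj.
by have := hmin j hj; rewrite leqNgt ji.
Qed.

Lemma gauss_normC c : gn c%:P = w c.
Proof.
apply/eqP; rewrite eq_le; apply/andP; split.
  apply: gauss_norm_le; first exact: ultra_ge0.
  move=> i; rewrite coefC; case: i => [|i] /=; first by rewrite mulr1.
  by rewrite ultra0 // mul0r ultra_ge0.
by have := coef_le_gauss_norm c%:P 0; rewrite coefC mulr1.
Qed.

Lemma gauss_norm_eq0 p : gn p = 0 <-> p = 0.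
Proof.
split=> [h|->]; last by rewrite -polyC0 gauss_normC ultra0.
apply/eqP; rewrite -lead_coef_eq0; apply/negP => /negP n0.
have : w (lead_coef p) * r ^+ (size p).-1 <= gn p by exact: coef_le_gauss_norm.
by rewrite h leNgt mulr_gt0 ?exprn_gt0 // ultra_gt0.
Qed.

Lemma gauss_normD p q : gn (p + q) <= Num.max (gn p) (gn q).
Proof.
apply: gauss_norm_le; first by rewrite le_max gauss_norm_ge0.
move=> i; rewrite coefD.
have ri : 0 <= r ^+ i by rewrite exprn_ge0 // ltW.
apply: le_trans (ler_wpM2r ri (ultraD hw _ _)) _.
by rewrite maxr_pMl // le_max2 // coef_le_gauss_norm.
Qed.

(** Gauss's lemma: if i0 and j0 are the first indices where the two maxima are
    reached, one term of coefficient i0 + j0 of the product strictly dominates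
    the others. *)
Lemma gauss_normM p q : gn (p * q) = gn p * gn q.
Proof.
have [->|p0] := eqVneq p 0.
  by rewrite mul0r (proj2 (gauss_norm_eq0 0) erefl) mul0r.
have [->|q0] := eqVneq q 0.
  by rewrite mulr0 (proj2 (gauss_norm_eq0 0) erefl) mulr0.
have gp : 0 < gn p.
  by rewrite lt_neqAle gauss_norm_ge0 andbT eq_sym; apply/eqP => /gauss_norm_eq0/eqP; apply/negP.
have gq : 0 < gn q.
  by rewrite lt_neqAle gauss_norm_ge0 andbT eq_sym; apply/eqP => /gauss_norm_eq0/eqP; apply/negP.
have term i j : w (p`_i * q`_j) * r ^+ (i + j) = (w p`_i * r ^+ i) * (w q`_j * r ^+ j).
  by rewrite ultraM // exprD; ring.
apply/eqP; rewrite eq_le; apply/andP; split.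
  apply: gauss_norm_le => [|k]; first by rewrite mulr_ge0 // gauss_norm_ge0.
  have rk : 0 < r ^+ k by rewrite exprn_gt0.
  rewrite -ler_pdivlMr // coefM; apply: ultra_sum_le => //.
    by rewrite divr_ge0 ?mulr_ge0 ?gauss_norm_ge0 // ltW.
  move=> i _; rewrite ler_pdivlMr //.
  have -> : r ^+ k = r ^+ (i + (k - i)) by rewrite subnKC // leq_ord.
  rewrite term.
  by apply: ler_pM; rewrite ?gauss_term_ge0 ?coef_le_gauss_norm.
have [i0 [hi0 mi0]] := gauss_norm_attained p0.
have [j0 [hj0 mj0]] := gauss_norm_attained q0.
have rk : 0 < r ^+ (i0 + j0) by rewrite exprn_gt0.
apply: le_trans (coef_le_gauss_norm (p * q) (i0 + j0)).
rewrite {1}hi0 {1}hj0 -term ler_pM2r // coefM.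
have hi : (i0 < (i0 + j0).+1)%N by rewrite ltnS leq_addr.
rewrite (bigD1 (Ordinal hi)) //= addKn ultraD_eq //.
apply: ultra_sum_lt => //.
  apply: ultra_gt0 => //; apply/eqP => h.
  have : gn p * gn q != 0 by rewrite mulf_neq0 // gt_eqF.
  by rewrite {1}hi0 {1}hj0 -term h ultra0 // mul0r eqxx.
move=> i /eqP ne; rewrite -(ltr_pM2r rk) term -hi0 -hj0.
have -> : r ^+ (i0 + j0) = r ^+ (i + (i0 + j0 - i)) by rewrite subnKC // leq_ord.
rewrite term.
have [lt|ge] := ltnP i i0.
  apply: le_lt_trans (_ : (w p`_i * r ^+ i) * gn q < _); last by rewrite ltr_pM2r // mi0.
  by apply: ler_wpM2l; rewrite ?gauss_term_ge0 ?coef_le_gauss_norm.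
have gt : (i0 < i)%N.
  by rewrite ltn_neqAle ge andbT; apply/eqP => e; apply: ne; apply: val_inj.
apply: le_lt_trans (_ : gn p * (w q`_(i0 + j0 - i) * r ^+ (i0 + j0 - i)) < _).
  by apply: ler_wpM2r; rewrite ?gauss_term_ge0 ?coef_le_gauss_norm.
by rewrite ltr_pM2l // mj0 //; have := leq_ord i; lia.
Qed.

Lemma gauss_ultranorm : ultranorm gn.
Proof.
split; [exact: gauss_norm_ge0 | exact: gauss_norm_eq0 | exact: gauss_normM |
  exact: gauss_normD].
Qed.

Lemma horner_le_gauss_norm p x : w x <= r -> w p.[x] <= gn p.
Proof.
move=> xr; rewrite horner_coef; apply: ultra_sum_le => //.
  exact: gauss_norm_ge0.
move=> i _; apply: le_trans (coef_le_gauss_norm p i).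
rewrite ultraM // ultraX //; apply: ler_wpM2l; first exact: ultra_ge0.
by apply: lerXn2r; rewrite ?nnegrE ?ultra_ge0 // ltW.
Qed.

End GaussNorm.

(** * Zeros of entire functions *)

Lemma absv_cvgP (R : realType) (K : fieldType) (v : K -> R) (u : nat -> K) l :
  nonarch_absolute_value v -> absv_cvg v u l <->
  forall e, 0 < e -> exists N, forall n, (N <= n)%N -> v (u n - l) < e.
Proof.
move=> hv; have vn x : `|v x| = v x by rewrite ger0_norm // absv_ge0.
rewrite /absv_cvg; split.
  move=> /cvgrPdist_lt h e e0; have [N _ hN] := h e e0.
  by exists N => n hn; have := hN n hn; rewrite /= sub0r normrN vn.
move=> h; apply/cvgrPdist_lt => e e0; have [N hN] := h e e0.
by exists N => // n hn; rewrite /= sub0r normrN vn; exact: hN.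
Qed.

Section Zeros.
Context (R : realType) (K : closedFieldType) (v : K -> R).
Context (hv : nonarch_absolute_value v).
Local Notation hu := (absv_ultranorm hv).
Local Notation gn := (gauss_norm v).

(** Entire functions are represented by sequences of polynomials that are Cauchy
    for all Gauss norms, such as the truncations of an everywhere convergent
    power series. Sums and products of entire functions are then computed on
    polynomials. *)
Definition gauss_cauchy (h : nat -> {poly K}) : Prop :=
  forall r e, 0 < r -> 0 < e -> exists N, forall m n, (N <= m)%N -> (N <= n)%N ->
    gn r (h m - h n) < e.

Definition gauss_cvg (h : nat -> {poly K}) (p : {poly K}) : Prop :=
  forall r e, 0 < r -> 0 < e -> exists N, forall n, (N <= n)%N ->
    gn r (h n - p) < e.

Lemma gauss_normXsubC r z : 0 < r -> gn r ('X - z%:P) = Num.max r (v z).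
Proof.
move=> r0; apply/eqP; rewrite eq_le; apply/andP; split.
  apply: gauss_norm_le; first by rewrite le_max ltW.
  move=> [|[|i]]; rewrite coefB coefX coefC /=.
  - by rewrite sub0r (ultraN hu) mulr1 le_max lexx orbT.
  - by rewrite subr0 (ultra1 hu) mul1r expr1 le_max lexx.
  - by rewrite subr0 (ultra0 hu) mul0r le_max ltW.
rewrite ge_max; apply/andP; split.
  apply: le_trans (coef_le_gauss_norm hu r ('X - z%:P) 1).
  by rewrite coefB coefX coefC /= subr0 (ultra1 hu) mul1r expr1.
apply: le_trans (coef_le_gauss_norm hu r ('X - z%:P) 0).
by rewrite coefB coefX coefC /= sub0r (ultraN hu) mulr1.
Qed.

(** Since K is algebraically closed, the roots of p determine both its absolute
    values and its Gauss norms. *)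
Lemma poly_split_norms (p : {poly K}) : exists s : seq K,
  [/\ forall z, z \in s -> root p z,
      forall x, v p.[x] = v (lead_coef p) * \prod_(z <- s) v (x - z) &
      forall r, 0 < r -> gn r p = v (lead_coef p) * \prod_(z <- s) Num.max r (v z)].
Proof.
have [s ps] := closed_field_poly_normal p; exists s; split.
- by move=> z zs; rewrite ps rootE hornerZ (eqP (_ : root _ z)) ?mulr0 // root_prod_XsubC.
- move=> x; rewrite {1}ps hornerZ (ultraM hu) horner_prod (ultra_prod hu).
  by congr (_ * _); apply: eq_bigr => z _; rewrite hornerXsubC.
move=> r r0; have hg := gauss_ultranorm hu r0.
rewrite {1}ps -mul_polyC (ultraM hg) (ultra_prod hg) (gauss_normC hu r).
by congr (_ * _); apply: eq_bigr => z _; rewrite gauss_normXsubC.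
Qed.

(** If all roots lay outside the disc of radius r, the constant coefficient
    would dominate. *)
Lemma root_in_disc (p : {poly K}) r :
  0 < r -> v p.[0] < gn r p -> exists2 z, root p z & v z < r.
Proof.
move=> r0 h; have [s [hs hx hr]] := poly_split_norms p.
have [/hasP[z zs zr]|/hasPn no] := boolP (has (fun z => v z < r) s).
  by exists z => //; exact: hs.
move: h; rewrite hx hr // => /lt_eqF/eqP; case; congr (_ * _).
rewrite !big_seq; apply: eq_bigr => z zs; rewrite sub0r (ultraN hu).
by apply/esym/max_idPr; rewrite leNgt no.
Qed.

(** The number of roots in the disc is bounded through the Gauss norm at
    radius 2r; a value of p that is small compared with p(0) then forces one
    of them to be close. *)
Lemma root_nearby (p : {poly K}) r d J x :
  0 < r -> 0 < d -> d <= r -> v x < r -> gn (2 * r) p < v p.[0] * 2 ^+ J ->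
  v p.[x] < v p.[0] * (d / r) ^+ J -> exists2 z, root p z & v (x - z) < d.
Proof.
move=> r0 d0 dr xr hJ hx0; have [s [hs hx hr]] := poly_split_norms p.
have [/hasP[z zs zr]|/hasPn no] := boolP (has (fun z => v (x - z) < d) s).
  by exists z => //; exact: hs.
have p00 : 0 < v p.[0].
  rewrite lt_neqAle (ultra_ge0 hu) andbT eq_sym; apply/eqP => h.
  by move: hx0; rewrite h mul0r ltNge (ultra_ge0 hu).
have l0 := ultra_ge0 hu (lead_coef p).
pose c := count (fun z => v z < r) s.
have e0 : v p.[0] = v (lead_coef p) * \prod_(z <- s) v z.
  by rewrite hx; congr (_ * _); apply: eq_bigr => z _; rewrite sub0r (ultraN hu).
have prodc (a : R) : \prod_(z <- s) ((if v z < r then a else 1) * v z) =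
    a ^+ c * \prod_(z <- s) v z.
  rewrite big_split /=; congr (_ * _); rewrite /c.
  elim: s {hs hx hr no c e0} => [|z s IH]; first by rewrite big_nil expr0.
  by rewrite big_cons IH /=; case: ifP => _; rewrite ?mul1r // add1n exprS.
have cJ : (c < J)%N.
  rewrite -(ltr_eXn2l (_ : 1 < 2 :> R)) ?ltr1n // -(ltr_pM2l p00).
  apply: le_lt_trans hJ; rewrite hr ?mulr_gt0 // e0 -mulrA.
  apply: ler_wpM2l => //; rewrite mulrC -prodc.
  apply: ler_prod => z _; apply/andP; split.
    by rewrite mulr_ge0 ?(ultra_ge0 hu) //; case: ifP.
  case: ifPn => zr; last by rewrite mul1r le_max lexx orbT.
  by rewrite le_max ler_pM2l // ltW.
suff : v p.[0] * (d / r) ^+ J <= v p.[x] by rewrite leNgt hx0.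
have dr1 : d / r <= 1 by rewrite ler_pdivrMr // mul1r.
have dr0 : 0 < d / r by rewrite divr_gt0.
apply: (@le_trans _ _ (v p.[0] * (d / r) ^+ c)).
  by rewrite ler_pM2l //; apply: ler_wiXn2l; rewrite ?(ltW dr0) // ltnW.
rewrite (hx x) e0 -mulrA; apply: ler_wpM2l => //; rewrite mulrC -prodc.
rewrite !big_seq; apply: ler_prod => z zs; apply/andP; split.
  by rewrite mulr_ge0 ?(ultra_ge0 hu) //; case: ifP; rewrite ?ler01 ?(ltW dr0).
case: ifPn => zr.
  apply: (@le_trans _ _ d); last by rewrite leNgt no.
  by rewrite -mulrA ger_pMr // mulrC ler_pdivrMr // mul1r ltW.
rewrite mul1r (ultraBC hu) (ultraD_eq hu) // (ultraN hu).
by apply: lt_le_trans xr _; rewrite leNgt.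
Qed.

Lemma horner_lipschitz (p : {poly K}) r x y :
  0 < r -> v x <= r -> v y <= r -> v (p.[x] - p.[y]) * r <= v (x - y) * gn r p.
Proof.
move=> r0 xr yr; rewrite -ler_pdivlMr //.
have g0 : 0 <= gn r p by exact: gauss_norm_ge0.
rewrite !horner_coef -sumrB; apply: (ultra_sum_le hu).
  by rewrite divr_ge0 ?mulr_ge0 ?(ultra_ge0 hu) // ltW.
move=> i _; rewrite -mulrBr subrXX !(ultraM hu).
rewrite ler_pdivlMr //; case: i => [[|i] hi] /=.
  by rewrite big_ord0 (ultra0 hu) !mulr0 mul0r mulr_ge0 // (ultra_ge0 hu).
have -> : forall a b c d : R, a * (b * c) * d = b * (a * (c * d)) by move=> *; ring.
apply: ler_wpM2l; first exact: (ultra_ge0 hu).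
apply: le_trans (coef_le_gauss_norm hu r p i.+1).
apply: ler_wpM2l; first exact: (ultra_ge0 hu).
rewrite exprSr ler_pM2r //; apply: (ultra_sum_le hu).
  by rewrite exprn_ge0 // ltW.
move=> [j hj] _ /=; rewrite (ultraM hu) !(ultraX hu).
have -> : r ^+ i = r ^+ (i.+1 - j.+1) * r ^+ j by rewrite -exprD; congr (_ ^+ _); lia.
rewrite subSS; apply: ler_pM; rewrite ?exprn_ge0 ?(ultra_ge0 hu) //;
  by apply: lerXn2r; rewrite ?nnegrE ?(ultra_ge0 hu) // ltW.
Qed.

End Zeros.

Section ZeroTheorem.
Context (R : realType) (K : closedFieldType) (v : K -> R).
Context (hv : nonarch_absolute_value v) (hK : absv_complete v).
Local Notation hu := (absv_ultranorm hv).
Local Notation gn := (gauss_norm v).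

Lemma gauss_cauchy_horner (h : nat -> {poly K}) z :
  gauss_cauchy v h -> exists l, absv_cvg v (fun n => (h n).[z]) l.
Proof.
move=> hc; apply: hK => e e0; pose r := Num.max 1 (v z).
have r0 : 0 < r by rewrite lt_max ltr01.
have [N hN] := hc r e r0 e0; exists N => m n hm hn.
rewrite -hornerN -hornerD; apply: le_lt_trans (hN m n hm hn).
by apply: (horner_le_gauss_norm hu) => //; rewrite le_max lexx orbT.
Qed.

Lemma gauss_cauchy_bounded (h : nat -> {poly K}) r :
  0 < r -> gauss_cauchy v h -> exists M N, forall n, (N <= n)%N -> gn r (h n) <= M.
Proof.
move=> r0 hc; have [N hN] := hc r 1 r0 ltr01.
exists (Num.max 1 (gn r (h N))), N => n hn.
have hg := gauss_ultranorm hu r0.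
rewrite -(subrK (h N) (h n)); apply: (ultraD_le hg).
  by rewrite le_max ltW // hN.
by rewrite le_max lexx orbT.
Qed.

(** Successive approximation: as the roots of one approximating polynomial are
    close to roots of all later ones, a Cauchy sequence of roots can be chosen;
    its limit is a zero of the limit function. *)
Lemma root_sequence (h : nat -> {poly K}) r :
  0 < r ->
  (exists N, forall n, (N <= n)%N -> exists2 z, root (h n) z & v z < r) ->
  (forall d, 0 < d -> exists N, forall m n z, (N <= m)%N -> (N <= n)%N ->
     root (h m) z -> v z < r -> exists2 z', root (h n) z' & v (z - z') < d) ->
  gauss_cauchy v h -> exists z, absv_cvg v (fun n => (h n).[z]) 0.
Proof.
move=> r0 [N0 ex0] near hc.
pose d k : R := r / 2 ^+ k.
have d0 k : 0 < d k by rewrite divr_gt0 ?exprn_gt0.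
have ddecr k j : (k <= j)%N -> d j <= d k.
  move=> kj; rewrite ler_pM2l // lef_pV2 ?posrE ?exprn_gt0 //.
  by apply: ler_weXn2l => //; rewrite ler1n.
have dr k : d k <= r.
  by have := ddecr 0 k (leq0n k); rewrite /d expr0 divr1.
have dsmall e : 0 < e -> exists k, d k < e.
  move=> e0; exists (Num.bound (r / e)); rewrite ltr_pdivrMr ?exprn_gt0 //.
  rewrite mulrC -ltr_pdivrMr //; apply: lt_trans (archi_boundP _) _.
    by rewrite divr_ge0 // ltW.
  by rewrite -natrX ltr_nat ltn_expl.
have [N hN] := choice (fun k => near (d k) (d0 k)).
pose n k := (N0 + \sum_(i < k.+1) N i + k)%N.
have nN k j : (k <= j)%N -> (N k <= n j)%N.
  move=> kj; rewrite /n (bigD1 (Ordinal (kj : (k < j.+1)%N))) //=; lia.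
have nN0 k : (N0 <= n k)%N by rewrite /n -addnA leq_addr.
have nk k : (k <= n k)%N by rewrite /n leq_addl.
have step (kz : nat * K) : exists z', root (h (n kz.1)) kz.2 -> v kz.2 < r ->
    [/\ root (h (n kz.1.+1)) z', v z' < r & v (kz.2 - z') < d kz.1].
  case: kz => k z /=.
  have [[rz vz]|no] := pselect (root (h (n k)) z /\ v z < r); last first.
    by exists 0 => rz vz; case: no.
  have [z' rz' dz'] := hN k (n k) (n k.+1) z (nN _ _ (leqnn k)) (nN _ _ (leqnSn k)) rz vz.
  exists z' => _ _; split=> //; rewrite -(subKr z z') (ultraBC hu).
  rewrite (ultraBC hu); apply: (ultraB_lt hu) => //.
  exact: lt_le_trans dz' (dr k).
have [f hf] := choice step.
have [z0 rz0 vz0] := ex0 (n 0%N) (nN0 0%N).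
pose z := fix z k := if k is j.+1 then f (j, z j) else z0.
have hz k : root (h (n k)) (z k) /\ v (z k) < r.
  by elim: k => [//|k [rk vk]]; have [] := hf (k, z k) rk vk.
have dz k : v (z k - z k.+1) < d k.
  by have [rk vk] := hz k; have [] := hf (k, z k) rk vk.
have dzj k j : v (z k - z (k + j)%N) < d k.
  elim: j => [|j IH]; first by rewrite addn0 subrr (ultra0 hu).
  rewrite addnS -(subrK (z (k + j)%N) (z k)) -addrA; apply: (ultraD_lt hu) => //.
  by apply: lt_le_trans (dz _) (ddecr _ _ (leq_addr _ _)).
have [l hl] : exists l, absv_cvg v z l.
  apply: hK => e e0; have [k hk] := dsmall e e0; exists k => i j hi hj.
  rewrite -(subrK (z k) (z i)) -addrA; apply: (ultraD_lt hu).
    by rewrite (ultraBC hu) -(subnKC hi); apply: lt_trans hk.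
  by rewrite -(subnKC hj); apply: lt_trans hk.
move/(absv_cvgP _ _ hv): hl => hl; exists l.
have vl : v l < r.
  have [k hk] := hl r r0; have hkk := hk k (leqnn k).
  rewrite -(subKr (z k) l); apply: (ultraB_lt hu) => //.
  by have [] := hz k.
apply/(absv_cvgP _ _ hv) => e e0; have [N1 h1] := hc r e r0 e0; exists N1 => m hm.
rewrite subr0.
have [M [N2 h2]] := gauss_cauchy_bounded r0 hc.
have M0 : 0 <= M by apply: le_trans (h2 N2 (leqnn _)); exact: gauss_norm_ge0.
have [N3 h3] := hl (e * r / (M + 1)) (divr_gt0 (mulr_gt0 e0 r0) (ltr_wpDl M0 ltr01)).
pose k := (N1 + N2 + N3)%N.
have kn := nk k.
rewrite -(subrK (h (n k)).[l] (h m).[l]); apply: (ultraD_lt hu).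
  rewrite -hornerN -hornerD; apply: le_lt_trans (h1 m (n k) hm _); last by rewrite /k in kn *; lia.
  by apply: (horner_le_gauss_norm hu) => //; exact: ltW.
have [/rootP rk vk] := hz k.
rewrite -[_.[l]]subr0 -rk -(ltr_pM2r r0).
apply: le_lt_trans (horner_lipschitz hv (h (n k)) r0 (ltW vl) (ltW vk)) _.
have := h3 k _; rewrite (ultraBC hu) ltr_pdivlMr ?ltr_wpDl // => /(_ _) h4.
apply: le_lt_trans (h4 _); last by rewrite /k; lia.
apply: ler_wpM2l; first exact: (ultra_ge0 hu).
apply: le_trans (h2 (n k) _) _; first by rewrite /k in kn *; lia.
by rewrite lerDl.
Qed.

(** If the limit h is not constant, then on a large enough disc its constant
    coefficient c is not dominant, so the approximating polynomials have roots
    there. The number of these roots is bounded, because each of them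
    contributes a factor 2 to the Gauss norm at twice the radius; so they vary
    continuously with the polynomial and accumulate at a zero of h. *)
Theorem zero_free_constant (h : nat -> {poly K}) :
  gauss_cauchy v h -> (forall z, ~ absv_cvg v (fun n => (h n).[z]) 0) ->
  exists2 c, c != 0 & gauss_cvg v h c%:P.
Proof.
move=> hc nz; have [c hc0] := gauss_cauchy_horner 0 hc.
have c0 : c != 0 by apply/eqP => c0; apply: (nz 0); rewrite -{2}c0.
exists c => //; move=> r e r0 e0; apply: contrapT => hno.
move/(absv_cvgP _ _ hv): hc0 => hc0.
have vc0 := ultra_gt0 hu c0.
have hgr := gauss_ultranorm hu r0.
(* at the radius rho * r the constant term is dominated by the rest, whose
   Gauss norm grows at least linearly with the radius *)
pose rho := Num.max 1 ((v c + 1) / e).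
have rho1 : 1 <= rho by rewrite le_max lexx.
have rho0 : 0 < rho by exact: lt_le_trans ltr01 rho1.
pose s := rho * r; have s0 : 0 < s by rewrite mulr_gt0.
have hgs := gauss_ultranorm hu s0.
have [N1 h1] := hc r e r0 e0.
have [N2 h2] := hc0 e e0; have [N3 h3] := hc0 (v c) vc0.
have val0 n : (N3 <= n)%N -> v (h n).[0] = v c.
  move=> hn; rewrite -(subrK c (h n).[0]) addrC (ultraD_eq hu) //.
  exact: h3.
have far n : (N1 <= n)%N -> e <= gn r (h n - c%:P).
  move=> hn; rewrite leNgt; apply/negP => hlt; apply: hno; exists N1 => m hm.
  rewrite -(subrK (h n) (h m)) -addrA; apply: (ultraD_lt hgr) => //.
  exact: h1.
have big n : (N1 + N2 + N3 <= n)%N -> v (h n).[0] < gn s (h n).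
  move=> hn; rewrite val0 ?(leq_trans _ hn) ?leq_addl //.
  have e' : e <= gn r (h n - (h n).[0]%:P).
    rewrite leNgt; apply/negP => hlt.
    have := far n; rewrite leNgt => /(_ _)/negP; apply.
      by apply: leq_trans hn; rewrite -addnA leq_addr.
    rewrite -(subrK (h n).[0]%:P (h n)) -addrA; apply: (ultraD_lt hgr) => //.
    rewrite -polyCB (gauss_normC hu) h2 //.
    by apply: leq_trans hn; rewrite addnAC leq_addl.
  have : rho * e <= gn s (h n).
    apply: (@le_trans _ _ (rho * gn r (h n - (h n).[0]%:P))); first by rewrite ler_pM2l.
    rewrite -ler_pdivlMl //; apply: gauss_norm_le.
      by rewrite mulr_ge0 ?invr_ge0 ?gauss_norm_ge0 // ltW.
    move=> [|i]; rewrite coefB coefC horner_coef0 /=.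
      by rewrite subrr (ultra0 hu) mul0r mulr_ge0 ?invr_ge0 ?gauss_norm_ge0 // ltW.
    rewrite subr0 ler_pdivlMl //; apply: le_trans (coef_le_gauss_norm hu s (h n) i.+1).
    rewrite mulrCA; apply: ler_wpM2l; first exact: (ultra_ge0 hu).
    rewrite exprMn; apply: ler_wpM2r; first exact: exprn_ge0 (ltW r0).
    rewrite exprS; apply: ler_peMr; first exact: ltW.
    exact: exprn_ege1.
  apply: lt_le_trans; apply: (@lt_le_trans _ _ (v c + 1)); first by rewrite ltrDl.
  by rewrite -ler_pdivrMr // le_max lexx orbT.
have s20 : 0 < 2 * s by rewrite mulr_gt0.
have [M [N4 h4]] := gauss_cauchy_bounded s20 hc.
have M0 : 0 <= M by apply: le_trans (h4 N4 (leqnn _)); exact: gauss_norm_ge0.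
pose J := Num.bound (M / v c).
have hJ : M < v c * 2 ^+ J.
  rewrite mulrC -ltr_pdivrMr //; apply: lt_trans (archi_boundP _) _.
    by rewrite divr_ge0 // ltW.
  by rewrite -natrX ltr_nat ltn_expl.
suff [z hz] : exists z, absv_cvg v (fun n => (h n).[z]) 0 by exact: (nz z).
apply: (root_sequence s0) => //.
  exists (N1 + N2 + N3)%N => n hn; have [z rz vz] := root_in_disc hv s0 (big n hn).
  by exists z.
move=> d d0; pose d' := Num.min d s.
have d'0 : 0 < d' by rewrite lt_min d0.
have d's : d' <= s by rewrite ge_min lexx orbT.
have eta0 : 0 < v c * (d' / s) ^+ J by rewrite mulr_gt0 ?exprn_gt0 ?divr_gt0.
have [N5 h5] := hc s _ s0 eta0; exists (N3 + N4 + N5)%N => m n z hm hn rz vz.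
have hn3 : (N3 <= n)%N by apply: leq_trans hn; rewrite -addnA leq_addr.
have hn4 : (N4 <= n)%N by apply: leq_trans hn; rewrite addnAC leq_addl.
have [] := @root_nearby _ _ _ hv (h n) s d' J z s0 d'0 d's vz.
- by rewrite val0 //; apply: le_lt_trans (h4 n hn4) hJ.
- rewrite val0 // -[(h n).[z]]subr0 -(rootP rz) -hornerN -hornerD.
  apply: le_lt_trans (h5 n m (leq_trans (leq_addl _ _) hn) (leq_trans (leq_addl _ _) hm)).
  by apply: (horner_le_gauss_norm hu) => //; exact: ltW.
move=> z' rz' hz'; exists z' => //; apply: lt_le_trans hz' _.
by rewrite ge_min lexx.
Qed.

End ZeroTheorem.

(** * Evaluation of polynomials in several variables *)

Lemma mpoly_alg_ind (n : nat) (S : comNzRingType) (P : {mpoly S[n]} -> Prop) :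
  (forall c, P c%:MP) -> (forall i, P 'X_i) ->
  (forall p q, P p -> P q -> P (p + q)) ->
  (forall p q, P p -> P q -> P (p * q)) -> forall p, P p.
Proof.
move=> hC hX hD hM p; rewrite (mpolyE p).
elim/big_ind: _ => [||m _]; first by rewrite -mpolyC0; exact: hC.
  exact: hD.
rewrite -mul_mpolyC; apply: (hM) => //; rewrite mpolyXE_id.
elim/big_ind: _ => [||i _]; first by rewrite -mpolyC1; exact: hC.
  exact: hM.
elim: (m i) => [|k IH]; first by rewrite expr0 -mpolyC1; exact: hC.
by rewrite exprS; exact: hM.
Qed.

Section Evaluation.
Context (n : nat) (S E : comNzRingType) (f : {rmorphism S -> E}).
Implicit Types (F : {mpoly S[n]}) (h : 'I_n -> E).

Lemma mmap_rmorph (E' : comNzRingType) (g : {rmorphism E -> E'}) h F :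
  g (mmap f h F) = mmap (g \o f) (fun i => g (h i)) F.
Proof.
rewrite /mmap rmorph_sum; apply: eq_bigr => m _ /=; rewrite rmorphM; congr (_ * _).
by rewrite /mmap1 rmorph_prod; apply: eq_bigr => i _; rewrite rmorphXn.
Qed.

Lemma eq_mmap (f1 f2 : S -> E) h1 h2 F :
  f1 =1 f2 -> h1 =1 h2 -> mmap f1 h1 F = mmap f2 h2 F.
Proof.
move=> fg hh; apply: eq_bigr => m _; rewrite fg; congr (_ * _).
by apply: eq_bigr => i _; rewrite hh.
Qed.

Lemma mmap_map_mpoly (S' : comNzRingType) (g : {rmorphism S' -> S}) h
    (F : {mpoly S'[n]}) : mmap f h (map_mpoly g F) = mmap (f \o g) h F.
Proof.
elim/mpoly_alg_ind: F => [c|i|p q hp hq|p q hp hq].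
- by rewrite map_mpolyC !mmapC.
- by rewrite map_mpolyX !mmapX.
- by rewrite !raddfD /= hp hq.
- by rewrite !rmorphM /= hp hq.
Qed.

Lemma mmap_homog d F (c : E) h : F \is d.-homog ->
  mmap f (fun i => c * h i) F = c ^+ d * mmap f h F.
Proof.
move=> /dhomogP hF; rewrite /mmap mulr_sumr !big_seq; apply: eq_bigr => m hm.
rewrite mulrCA; congr (_ * _); have <- : mdeg m = d by exact: hF.
rewrite /mmap1 mdegE.
rewrite (eq_bigr _ (fun i _ => exprMn _ _ _)) big_split /=; congr (_ * _).
by rewrite expr_sum.
Qed.

(** The Taylor expansion of F(h + s y) to first order in s. *)
Lemma mmap_line_coef F h y :
  let P := mmap (polyC \o f) (fun i => (h i)%:P + (y i)%:P * 'X) F in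
  P`_0 = mmap f h F /\ P`_1 = \sum_i mmap f h F^`M(i) * y i.
Proof.
elim/mpoly_alg_ind: F => [c|i|p q [p0 p1] [q0 q1]|p q [p0 p1] [q0 q1]] /=.
- rewrite !mmapC /= !coefC /=; split=> //.
  by rewrite big1 // => i _; rewrite mderivC mmap0 mul0r.
- rewrite !mmapX !mmap1U !coefD !coefC !coefMX !coefC /=; split; first by rewrite addr0.
  rewrite add0r (bigD1 i) //= big1 ?addr0 => [|j ji].
    by rewrite mderivX mnm1E eqxx scale1r -{1}[U_(i)%MM]add0m addmK ?mpolyX0 ?rmorph1 ?mul1r.
  by rewrite mderivX mnm1E eq_sym (negbTE ji) scale0r mmap0 mul0r.
- rewrite !raddfD /= !coefD p0 q0 p1 q1; split=> //.
  by rewrite -big_split /=; apply: eq_bigr => i _; rewrite mderivD raddfD mulrDl.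
- rewrite !rmorphM /= !coefM !big_ord_recl !big_ord0 /= !addr0 !subn0 /bump /= subnn.
  rewrite p0 q0 p1 q1; split=> //.
  rewrite mulr_sumr mulr_suml addrC -big_split /=; apply: eq_bigr => i _.
  by rewrite mderivM raddfD /= !rmorphM /=; ring.
Qed.

End Evaluation.

Definition mnorm (R : realType) (n : nat) (S : comNzRingType) (v : S -> R)
    (F : {mpoly S[n]}) : R := \sum_(m <- msupp F) v F@_m.

Lemma mmap_le (R : realType) (n : nat) (S E : comNzRingType)
    (f : {rmorphism S -> E}) (v : S -> R) (w : E -> R) d (F : {mpoly S[n]})
    (h : 'I_n -> E) (X : R) :
  ultranorm w -> (forall c, w (f c) = v c) -> F \is d.-homog -> 0 <= X ->
  (forall i, w (h i) <= X) -> w (mmap f h F) <= mnorm v F * X ^+ d.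
Proof.
move=> hw fv /dhomogP hF X0 hX.
have v0 c : 0 <= v c by rewrite -fv (ultra_ge0 hw).
have M0 : 0 <= mnorm v F by apply: sumr_ge0.
rewrite /mmap big_seq; apply: (ultra_sum_le hw).
  by rewrite mulr_ge0 // exprn_ge0.
move=> m hm; rewrite (ultraM hw) fv; apply: ler_pM => //.
- exact: (ultra_ge0 hw).
- rewrite /mnorm (big_rem m) //= lerDl; exact: sumr_ge0.
have <- : mdeg m = d by exact: hF.
rewrite /mmap1 (ultra_prod hw) mdegE expr_sum.
apply: ler_prod => i _; rewrite (ultraX hw) exprn_ge0 ?(ultra_ge0 hw) //=.
by apply: lerXn2r; rewrite ?nnegrE ?(ultra_ge0 hw).
Qed.

Lemma mnorm_ge0 (R : realType) (n : nat) (S : comNzRingType) (v : S -> R)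
  (F : {mpoly S[n]}) : ultranorm v -> 0 <= mnorm v F.
Proof. by move=> hv; apply: sumr_ge0 => m _; exact: (ultra_ge0 hv). Qed.

Lemma pihomogM (n : nat) (S : comNzRingType) d e (A F : {mpoly S[n]}) :
  F \is d.-homog -> (d <= e)%N ->
  pihomog mdeg e (A * F) = pihomog mdeg (e - d) A * F.
Proof.
move=> hF de; rewrite {1}(mpolyE A) mulr_suml raddf_sum /= pihomogE mulr_suml.
rewrite [RHS]big_mkcond /=; apply: eq_bigr => m _.
have hm : (A@_m *: 'X_[m]) * F \is (mdeg m + d).-homog.
  by apply: dhomogM => //; apply: rpredZ; rewrite dhomogX.
case: eqP => h; first by rewrite pihomog_dE // -(subnK de) -h.
by rewrite (pihomog_ne0 _ hm) //; apply/eqP; lia.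
Qed.

Lemma mderiv_homog (n : nat) (S : comNzRingType) d (F : {mpoly S[n]}) i :
  F \is d.-homog -> F^`M(i) \is d.-1.-homog.
Proof.
move=> /dhomogP hF; apply/dhomogP => m; rewrite mcoeff_msupp mcoeff_mderiv => h.
have : (m + U_(i))%MM \in msupp F.
  by rewrite mcoeff_msupp; apply: contraNneq h => ->; rewrite mul0rn.
by move=> /hF /= <-; rewrite mdegD mdeg1 addn1.
Qed.

Definition ox : 'I_3 := @Ordinal 3 0 isT.
Definition oy : 'I_3 := @Ordinal 3 1 isT.
Definition oz : 'I_3 := @Ordinal 3 2 isT.

Lemma ord3P (P : 'I_3 -> Prop) : P ox -> P oy -> P oz -> forall i, P i.
Proof.
move=> h0 h1 h2 [[|[|[|i]]] hi] //;
  [move: h0|move: h1|move: h2]; congr P; exact: val_inj.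
Qed.

Lemma sum_ord3 (V : nmodType) (F : 'I_3 -> V) :
  \sum_i F i = F ox + F oy + F oz.
Proof.
by rewrite !big_ord_recl big_ord0 addr0 addrA; congr (F _ + F _ + F _); apply: val_inj.
Qed.

(** * Pairs of forms in general position *)

Section Degeneracy.
Context (S : comNzRingType).
Implicit Types F : {mpoly S[3]}.

(** At a common zero a of F1 and F2 with a_z = 1, Euler's relation makes the
    vanishing of this single minor equivalent to the dependence of the two
    gradients. *)
Definition jac F1 F2 := F1^`M(ox) * F2^`M(oy) - F1^`M(oy) * F2^`M(ox).

(** The direction of the tangent in the chart z = 1. *)
Definition tangent F (i : 'I_3) : {mpoly S[3]} :=
  if i == ox then - F^`M(oy) else if i == oy then F^`M(ox) else 0.

Definition tangent_expansion F : {poly {mpoly S[3]}} :=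
  mmap (polyC \o @mpolyC 3 S) (fun i => ('X_i)%:P + (tangent F i)%:P * 'X) F.

(** The second order term of F along its tangent, so that a zero of F and of
    [flex F] in the chart z = 1 is a point of contact of order at least 3. A
    coefficient is used rather than second derivatives because the Hessian
    degenerates in characteristic 2. *)
Definition flex F := (tangent_expansion F)`_2.

Definition degeneracy (d1 d2 : nat) F1 F2 :=
  jac F1 F2 * (if d1 == 1%N then flex F2 else 1)
            * (if d2 == 1%N then flex F1 else 1).

Definition degeneracy_deg (d1 d2 : nat) : nat :=
  ((d1.-1 + d2.-1) + (if d1 == 1 then 3 * d2 - 4 else 0)
                   + (if d2 == 1 then 3 * d1 - 4 else 0))%N.

(** F1, F2 and X_oz * degeneracy have no common zero but the origin, in an
    effective form: the monomials of some degree belong to the ideal of these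
    three forms. The factor X_oz also keeps the common zeros of F1 and F2 away
    from the line z = 0. *)
Definition generic_pair (d1 d2 : nat) F1 F2 : Prop :=
  exists N, [/\ (d1 <= N)%N, (d2 <= N)%N, (degeneracy_deg d1 d2 <= N)%N &
  forall m : 'X_{1..3}, mdeg m = N.+1 -> exists A B C : {mpoly S[3]},
    [/\ A \is (N.+1 - d1).-homog, B \is (N.+1 - d2).-homog,
        C \is (N - degeneracy_deg d1 d2).-homog &
        'X_[m] = A * F1 + B * F2 + C * ('X_oz * degeneracy d1 d2 F1 F2)]].

End Degeneracy.

Lemma flex_meval (S : comNzRingType) (F : {mpoly S[3]}) (a : 'I_3 -> S) :
  (flex F).@[a] =
  (mmap polyC (fun i => (a i)%:P + (tangent F i).@[a]%:P * 'X) F)`_2.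
Proof.
rewrite /flex -[LHS](coef_map (meval a)) /tangent_expansion mmap_rmorph; congr (nth 0 (polyseq _) 2).
apply: eq_mmap => [c|i] /=; first by rewrite map_polyC /= mevalC.
by rewrite rmorphD rmorphM /= !map_polyC map_polyX /= mevalXU.
Qed.

Section DegeneracyHomog.
Context (S : comNzRingType).
Implicit Types F : {mpoly S[3]}.

Lemma jac_homog d1 d2 F1 F2 : F1 \is d1.-homog -> F2 \is d2.-homog ->
  jac F1 F2 \is (d1.-1 + d2.-1).-homog.
Proof. by move=> h1 h2; apply: rpredB; apply: dhomogM; apply: mderiv_homog. Qed.

(** Weighted homogeneity, with weight -e for the auxiliary variable. *)
Definition graded (d e : nat) (P : {poly {mpoly S[3]}}) : Prop :=
  forall k, P`_k \is (d + k * e).-homog.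

Lemma gradedM d d' e P Q : graded d e P -> graded d' e Q -> graded (d + d') e (P * Q).
Proof.
move=> hP hQ k; rewrite coefM; apply: rpred_sum => i _.
have -> : (d + d' + k * e = (d + i * e) + (d' + (k - i) * e))%N.
  by rewrite mulnBl; have := leq_mul (leq_ord i) (leqnn e); lia.
exact: dhomogM.
Qed.

Lemma graded_tangent d F : (1 < d)%N -> F \is d.-homog ->
  graded d (d - 2) (tangent_expansion F).
Proof.
move=> d1 hF; have hF' := hF; move/dhomogP: hF' => hm.
rewrite /tangent_expansion /mmap big_seq => k; rewrite coef_sum; apply: rpred_sum => m hmF.
rewrite /= coefCM mul_mpolyC; apply: rpredZ.
have gi i : graded 1 (d - 2) (('X_i)%:P + (tangent F i)%:P * 'X).
  move=> j; rewrite coefD coefC coefMX coefC; case: j => [|[|j]] /=.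
  - by rewrite addr0 dhomogX; apply/eqP; exact: mdeg1.
  - rewrite add0r; have -> : (1 + 1 * (d - 2) = d.-1)%N by lia.
    rewrite /tangent; case: ifP => _; first by rewrite rpredN mderiv_homog.
    by case: ifP => _; [exact: mderiv_homog | exact: rpred0].
  - by rewrite addr0 rpred0.
have gX i n : graded n (d - 2) ((('X_i)%:P + (tangent F i)%:P * 'X) ^+ n).
  elim: n => [|n IH]; last by rewrite exprS; exact: gradedM (gi i) IH.
  by move=> j; rewrite expr0 coefC; case: j => [|j] /=; rewrite ?rpred0 ?dhomog1.
have hd : mdeg m = d by exact: hm.
suff : graded (mdeg m) (d - 2)
    (mmap1 (fun i => ('X_i)%:P + (tangent F i)%:P * 'X) m) by rewrite hd; exact.
rewrite mdegE /mmap1; elim/big_rec2: _ => [|i P d' _ IH]; first exact: (gX ox 0%N).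
exact: gradedM (gX _ _) IH.
Qed.

Lemma flex_homog d F : (1 < d)%N -> F \is d.-homog -> flex F \is (3 * d - 4).-homog.
Proof.
move=> d1 hF; have := graded_tangent d1 hF 2.
by have -> : (d + 2 * (d - 2) = 3 * d - 4)%N by lia.
Qed.

Lemma degeneracy_homog d1 d2 F1 F2 : (4 <= d1 + d2)%N ->
  F1 \is d1.-homog -> F2 \is d2.-homog ->
  degeneracy d1 d2 F1 F2 \is (degeneracy_deg d1 d2).-homog.
Proof.
move=> hd h1 h2; apply: dhomogM; first apply: dhomogM.
- exact: jac_homog.
- by case: eqP => [e|_]; [apply: flex_homog => //; lia | exact: dhomog1].
- by case: eqP => [e|_]; [apply: flex_homog => //; lia | exact: dhomog1].
Qed.

End DegeneracyHomog.

(** Monomials of degree d, in the enumeration of form_coef. *)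
Definition mon (d : nat) (i : 'I_#|monomials3 d|) : 'X_{1..3} := val (enum_val i).

Lemma mdeg_mon d (i : 'I_#|monomials3 d|) : mdeg (mon i) = d.
Proof. by apply/eqP; exact: (enum_valP i). Qed.

Lemma mon_surj d (m : 'X_{1..3}) : mdeg m = d -> exists i : 'I_#|monomials3 d|, mon i = m.
Proof.
move=> hm; have lt : (mdeg m < d.+1)%N by rewrite hm.
have hin : BMultinom lt \in monomials3 d by apply/eqP.
by exists (enum_rank_in hin (BMultinom lt)); rewrite /mon enum_rankK_in.
Qed.

Lemma mon_inj d : injective (@mon d).
Proof. by move=> i j /val_inj /enum_val_inj. Qed.

Lemma homog_expand (S : comNzRingType) d (F : {mpoly S[3]}) : F \is d.-homog ->
  F = \sum_(i < #|monomials3 d|) F@_(mon i) *: 'X_[mon i].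
Proof.
move=> hF; have hs : (msize F <= d.+1)%N.
  by rewrite msizeE; apply/bigmax_leqP_seq => m hm _; rewrite ltnS (dhomogP _ _ _ hF).
rewrite {1}(mpolywE hs) (bigID (monomials3 d)) /= [X in _ + X]big1 ?addr0.
  exact: (big_enum_val (fun m : 'X_{1..3 < d.+1} => F@_m *: 'X_[m])).
move=> m hm; rewrite (dhomog_nemf_coeff hF) ?scale0r //.
Qed.

(** Over an algebraically closed field, multiplication by x on a finite system
    that is stable modulo an ideal, up to the factor z, is annihilated by a
    product of forms x - c z: the Cayley-Hamilton theorem, homogenized. *)
Lemma cayley_hamilton_ideal (K : closedFieldType) (A : comNzRingType)
    (f : {rmorphism K -> A}) (I : A -> Prop) (x z : A) n (m : 'I_n -> A)
    (C : 'M[K]_n) :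
  I 0 -> (forall p q, I p -> I q -> I (p + q)) -> (forall p q, I q -> I (p * q)) ->
  (forall i, I (x * m i - z * \sum_j f (C i j) * m j)) ->
  exists s : seq K, forall i, I (\prod_(c <- s) (x - f c * z) * m i).
Proof.
move=> I0 ID IM; case: n m C => [|n] m C hC; first by exists [::] => -[].
have [s hs] := closed_field_poly_normal (char_poly C); exists s => i.
have hs1 : char_poly C = \prod_(c <- s) ('X - c%:P).
  by rewrite {1}hs (eqP (char_poly_monic C)) scale1r.
have gen (t : seq K) k : I (\prod_(c <- t) (x - f c * z) * m k -
    z ^+ size t * \sum_j f (horner_mx C (\prod_(c <- t) ('X - c%:P)) k j) * m j).
  elim: t k => [|c t IH] k.
    rewrite !big_nil mul1r expr0 mul1r rmorph1 (bigD1 k) //= big1 ?addr0.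
      by rewrite mxE eqxx rmorph1 mul1r subrr.
    by move=> j jk; rewrite mxE eq_sym (negbTE jk) rmorph0 mul0r.
  rewrite !big_cons rmorphM /= rmorphB /= horner_mx_X horner_mx_C exprS.
  set P := horner_mx C _; set Q := \prod_(_ <- t) _.
  have e1 := IM Q _ (hC k).
  have e2 : I (\sum_j z * f ((C - c%:M) k j) * (Q * m j - z ^+ size t * \sum_l f (P j l) * m l)).
    by elim/big_ind: _ => // j _; apply: IM; exact: IH.
  have := ID _ _ e1 e2; congr I.
  have -> : \sum_j f (((C - c%:M) * P) k j) * m j =
     \sum_j f ((C - c%:M) k j) * \sum_l f (P j l) * m l.
    rewrite (eq_bigr (fun j => \sum_l f ((C - c%:M) k l) * (f (P l j) * m j))).
      by rewrite exchange_big; apply: eq_bigr => j _; rewrite mulr_sumr.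
    move=> j _; rewrite mxE rmorph_sum mulr_suml; apply: eq_bigr => l _.
    by rewrite rmorphM mulrA.
  have -> : \sum_j f (C k j) * m j =
      \sum_j f ((C - c%:M) k j) * m j + f c * m k.
    have -> : f c * m k = \sum_j f (c%:M k j : K) * m j.
      rewrite (bigD1 k) //= big1 ?addr0; first by rewrite mxE eqxx.
      by move=> j jk; rewrite mxE eq_sym (negbTE jk) rmorph0 mul0r.
    rewrite -big_split /=; apply: eq_bigr => j _.
    by rewrite !mxE rmorphB /= mulrBl subrK.
  have -> : \sum_j z * f ((C - c%:M) k j) * (Q * m j - z ^+ size t * \sum_l f (P j l) * m l) =
     Q * z * (\sum_j f ((C - c%:M) k j) * m j) -
     z * z ^+ size t * \sum_j f ((C - c%:M) k j) * \sum_l f (P j l) * m l.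
    rewrite !mulr_sumr -sumrB; apply: eq_bigr => j _; ring.
  ring.
have := gen s i; rewrite -hs1 Cayley_Hamilton.
rewrite [X in _ - _ * X]big1 ?mulr0 ?subr0 // => j _.
by rewrite mxE rmorph0 mul0r.
Qed.

(** * Maps that are close to two curves *)

(** Taylor expansion at the point t a, with an ultrametric remainder: the Gauss
    norm of radius X / Y on polynomials in an auxiliary variable s bounds all the
    coefficients of F(t a + s y) at once. *)
Lemma taylor_estimate (R : realType) (n : nat) (S E : comNzRingType)
    (f : {rmorphism S -> E}) (v : S -> R) (w : E -> R) d (F : {mpoly S[n]})
    (a : 'I_n -> S) (t : E) (y : 'I_n -> E) (X Y : R) :
  ultranorm w -> (forall c, w (f c) = v c) -> (0 < d)%N -> F \is d.-homog ->
  0 < Y -> Y <= X -> (forall i, w (t * f (a i)) <= X) -> (forall i, w (y i) <= Y) ->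
  let Fp := mmap f (fun i => t * f (a i) + y i) F in
  let L := \sum_i f F^`M(i).@[a] * y i in
  w (Fp - t ^+ d * f F.@[a]) <= mnorm v F * X ^+ d * (Y / X) /\
  w (Fp - t ^+ d * f F.@[a] - t ^+ d.-1 * L) <= mnorm v F * X ^+ d * (Y / X) ^+ 2.
Proof.
move=> hw fv d0 hF Y0 YX ha hy Fp L.
have X0 : 0 < X by exact: lt_le_trans YX.
have rho0 : 0 < X / Y by rewrite divr_gt0.
have th0 : 0 <= Y / X by rewrite divr_ge0 // ltW.
have th1 : Y / X <= 1 by rewrite ler_pdivrMr // mul1r.
have hg := gauss_ultranorm hw rho0.
pose P := mmap (polyC \o f) (fun i => (t * f (a i))%:P + (y i)%:P * 'X) F.
have evf (G : {mpoly S[n]}) : mmap f (fun i => f (a i)) G = f G.@[a].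
  by rewrite /meval mmap_rmorph; exact: eq_mmap.
have Peval : P.[1] = Fp.
  rewrite -[P.[1]]/(horner_eval 1 P) /P mmap_rmorph; apply: eq_mmap => [c|i] /=.
    by rewrite /horner_eval hornerC.
  by rewrite /horner_eval !hornerE.
have [P0 P1] := mmap_line_coef f F (fun i => t * f (a i)) y.
rewrite -/P (mmap_homog _ _ _ hF) evf in P0.
have P1' : P`_1 = t ^+ d.-1 * L.
  rewrite P1 /L mulr_sumr; apply: eq_bigr => i _.
  by rewrite (mmap_homog _ _ _ (mderiv_homog i hF)) evf mulrA.
have m0 : 0 <= mnorm v F.
  by apply: sumr_ge0 => m _; rewrite -fv (ultra_ge0 hw).
have Pk k : w P`_k <= mnorm v F * X ^+ d * (Y / X) ^+ k.
  have : gauss_norm w (X / Y) P <= mnorm v F * X ^+ d.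
    apply: (mmap_le hg) => // [c||i].
    - by rewrite /= (gauss_normC hw).
    - exact: ltW.
    apply: (ultraD_le hg); first by rewrite (gauss_normC hw).
    rewrite (ultraM hg) (gauss_normC hw).
    have -> : gauss_norm w (X / Y) 'X = X / Y.
      apply/eqP; rewrite eq_le; apply/andP; split.
        apply: gauss_norm_le => [|j]; first exact: ltW.
        rewrite coefX; case: eqP => [->|_]; first by rewrite (ultra1 hw) mul1r.
        by rewrite (ultra0 hw) mul0r ltW.
      by have := coef_le_gauss_norm hw (X / Y) 'X 1; rewrite coefX (ultra1 hw) mul1r.
    by rewrite mulrA ler_pdivrMr // mulrC ler_pM2l.
  move/(le_trans (coef_le_gauss_norm hw (X / Y) P k)).
  by rewrite -ler_pdivlMr ?exprn_gt0 // -exprVn invf_div.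
have Q1 (Q : {poly E}) c : 0 <= c -> (forall k, w Q`_k <= c) -> w Q.[1] <= c.
  move=> c0 hQ; rewrite horner_coef; apply: (ultra_sum_le hw) => // i _.
  by rewrite expr1n mulr1.
have b0 k : 0 <= mnorm v F * X ^+ d * (Y / X) ^+ k.
  by rewrite !mulr_ge0 ?exprn_ge0 // ltW.
have thk j k : (j <= k)%N -> (Y / X) ^+ k <= (Y / X) ^+ j by exact: ler_wiXn2l.
have c0 : 0 <= mnorm v F * X ^+ d by rewrite mulr_ge0 // exprn_ge0 // ltW.
split.
  have := Q1 (P - (P`_0)%:P) _ (b0 1%N).
  rewrite hornerD hornerN hornerC Peval P0 expr1; apply.
  move=> [|k]; rewrite coefB coefC /=.
    by rewrite P0 subrr (ultra0 hw); have := b0 1%N; rewrite expr1.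
  rewrite subr0; apply: le_trans (Pk _) _; apply: ler_wpM2l => //.
  by rewrite -[leRHS]expr1; exact: thk.
have := Q1 (P - (P`_0)%:P - (P`_1)%:P * 'X) _ (b0 2%N).
rewrite !(hornerD, hornerN, hornerM, hornerC, hornerX) mulr1 Peval P0 P1'; apply.
have b2 := b0 2%N; move=> [|[|k]]; rewrite !coefB coefC coefMX coefC /=.
- by rewrite P0 subr0 subrr (ultra0 hw) b2.
- by rewrite subr0 P1' subrr (ultra0 hw) b2.
by rewrite !subr0; apply: le_trans (Pk _) _; apply: ler_wpM2l => //; exact: thk.
Qed.

(** Monomials of degree N + 1 lie in (F1, F2) + (X_oz), hence multiplication by
    X_e on forms of degree N is X_oz times a scalar matrix modulo (F1, F2). The
    values of X_e / X_oz at the common zeros of F1 and F2 are among the elements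
    of s. *)
Lemma asymptotic_factor (K : closedFieldType) (d1 d2 : nat) (F1 F2 : {mpoly K[3]})
    (e : 'I_3) :
  (4 <= d1 + d2)%N -> F1 \is d1.-homog -> F2 \is d2.-homog ->
  generic_pair d1 d2 F1 F2 ->
  exists (s : seq K) (N : nat) (A B : {mpoly K[3]}),
  [/\ (d1 <= N)%N, (d2 <= N)%N,
      A \is (size s + N - d1).-homog, B \is (size s + N - d2).-homog &
      \prod_(c <- s) ('X_e - c%:MP * 'X_oz) * 'X_oz ^+ N = A * F1 + B * F2].
Proof.
move=> hd h1 h2 [N [hN1 hN2 hN hm]].
pose I (P : {mpoly K[3]}) := exists A B, P = A * F1 + B * F2.
have I0 : I 0 by exists 0, 0; rewrite !mul0r addr0.
have ID p q : I p -> I q -> I (p + q).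
  by move=> [A [B ->]] [A' [B' ->]]; exists (A + A'), (B + B'); ring.
have IM p q : I q -> I (p * q).
  by move=> [A [B ->]]; exists (p * A), (p * B); ring.
have red (i : 'I_#|monomials3 N|) : exists D : {mpoly K[3]}, D \is N.-homog /\
    I ('X_e * 'X_[mon i] - 'X_oz * D).
  have [|A [B [C [_ _ hC E]]]] := hm (U_(e) + mon i)%MM.
    by rewrite mdegD mdeg1 mdeg_mon.
  exists (C * degeneracy d1 d2 F1 F2); split.
    by rewrite -(subnK hN); apply: dhomogM => //; exact: degeneracy_homog.
  by rewrite -mpolyXD E; exists A, B; ring.
have [D hD] := choice red.
pose C : 'M[K]_#|monomials3 N| := \matrix_(i, j) (D i)@_(mon j).
have [|s hs] := @cayley_hamilton_ideal K {mpoly K[3]} (@mpolyC 3 K) I 'X_e 'X_oz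
  #|monomials3 N| (fun i => 'X_[mon i]) C I0 ID IM.
  move=> i; have [hDi] := hD i.
  rewrite {1}(homog_expand hDi); congr (I (_ - _ * _)).
  by apply: eq_bigr => j _; rewrite mxE mul_mpolyC.
have [i hi] : exists i : 'I_#|monomials3 N|, mon i = (U_(oz) *+ N)%MM.
  by apply: mon_surj; rewrite mdegMn mdeg1 mul1n.
have [A [B E]] := hs i; rewrite hi -mpolyXn in E.
have hL : \prod_(c <- s) ('X_e - c%:MP * 'X_oz) * 'X_oz ^+ N \is (size s + N).-homog.
  apply: dhomogM.
    elim: s {hs E} => [|c s IH]; first by rewrite big_nil dhomog1.
    rewrite big_cons -[size _]/(1 + size s)%N; apply: dhomogM => //.
    have hX j : ('X_j : {mpoly K[3]}) \is 1.-homog.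
      by rewrite dhomogX; apply/eqP; exact: mdeg1.
    by apply: rpredB => //; rewrite mul_mpolyC; apply: rpredZ.
  rewrite mpolyXn dhomogX; apply/eqP; change (mdeg (U_(oz) *+ N)%MM = N).
  by rewrite mdegMn mdeg1 mul1n.
exists s, N, (pihomog mdeg (size s + N - d1) A), (pihomog mdeg (size s + N - d2) B).
split=> //; try exact: pihomogP.
rewrite -(pihomog_dE hL) E raddfD /= (pihomogM _ h1) ?(pihomogM _ h2) //;
  exact: leq_trans (leq_addl _ _).
Qed.

Lemma leq_subS d N : (0 < d)%N -> (N.+1 - d <= N)%N.
Proof. by case: d => // d _; rewrite subSS leq_subr. Qed.

Lemma le_sum4 (R : realType) (x1 x2 x3 x4 : R) :
  0 <= x1 -> 0 <= x2 -> 0 <= x3 -> 0 <= x4 ->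
  [/\ x1 <= x1 + x2 + x3 + x4, x2 <= x1 + x2 + x3 + x4,
      x3 <= x1 + x2 + x3 + x4 & x4 <= x1 + x2 + x3 + x4].
Proof. by move=> *; split; lra. Qed.

Section Estimates.
Context (R : realType) (K : closedFieldType) (v : K -> R).
Context (hv : nonarch_absolute_value v).
Context (d1 d2 : nat) (d1_gt0 : (0 < d1)%N) (d2_gt0 : (0 < d2)%N).
Context (hd : (4 <= d1 + d2)%N) (F1 F2 : {mpoly K[3]}).
Context (h1 : F1 \is d1.-homog) (h2 : F2 \is d2.-homog).
Context (nd : generic_pair d1 d2 F1 F2) (c0 : R) (c0_ge0 : 0 <= c0).
Local Notation hu := (absv_ultranorm hv).
Local Notation gn := (gauss_norm v).

(** Up to the bounded quantity c0, the polynomials p satisfy the equations of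
    both curves; X is their size on the circle of radius r. *)
Definition near_curve (r : R) (p : 'I_3 -> {poly K}) (X : R) : Prop :=
  [/\ 0 < r, forall i, gn r (p i) <= X, exists i, gn r (p i) = X,
      gn r (mmap polyC p F1) <= c0 & gn r (mmap polyC p F2) <= c0].

Lemma gauss_mmap_le r p X d (A : {mpoly K[3]}) : 0 < r -> 0 <= X ->
  (forall i, gn r (p i) <= X) -> A \is d.-homog ->
  gn r (mmap polyC p A) <= mnorm v A * X ^+ d.
Proof.
move=> r0 X0 hp hA; apply: (mmap_le (gauss_ultranorm hu r0)) => // c.
exact: (gauss_normC hu).
Qed.

(** Some p_i has norm X; writing X_i^(N+1) in the ideal of F1, F2 and X_oz and
    evaluating at p leaves X^(N+1) <= Q X^N max(c0, |p_z|). *)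
Lemma near_curve_oz : exists k M, [/\ 0 < k, 1 <= M & forall r p X,
  near_curve r p X -> M <= X -> k * X <= gn r (p oz)].
Proof.
have [N [hN1 hN2 hN hm]] := nd.
have hE := degeneracy_homog hd h1 h2; move: hm hE; set E := degeneracy d1 d2 F1 F2; move: E => E hm hE.
have [A hA] := choice (fun i : 'I_3 => hm (U_(i) *+ N.+1)%MM
  (etrans (mdegMn _ _) (etrans (congr1 (muln^~ _) (mdeg1 _)) (mul1n _)))).
have {hA} [B hA] := choice hA; have {hA} [C hA] := choice hA.
pose Q := 1 + \sum_(i < 3) (mnorm v (A i) + mnorm v (B i) + mnorm v (C i * E)).
have m0 i : 0 <= mnorm v (A i) + mnorm v (B i) + mnorm v (C i * E).
  by rewrite !addr_ge0 ?mnorm_ge0 //; exact: hu.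
have Q0 : 0 < Q by rewrite ltr_pwDl // sumr_ge0.
have QA i : mnorm v (A i) + mnorm v (B i) + mnorm v (C i * E) <= Q.
  by rewrite /Q (bigD1 i) //= addrCA lerDl addr_ge0 // sumr_ge0.
exists Q^-1, (1 + Q * c0); split; first by rewrite invr_gt0.
  by rewrite lerDl mulr_ge0 // ltW.
move=> r p X [r0 hp [i hi] hc1 hc2] MX.
have X1 : 1 <= X by apply: le_trans MX; rewrite lerDl mulr_ge0 // ltW.
have X0 : 0 < X by exact: lt_le_trans ltr01 X1.
have hg := gauss_ultranorm hu r0.
have [hAi hBi hCi eq_i] := hA i.
have mA : mnorm v (A i) <= Q.
  by apply: le_trans (QA i); rewrite -addrA lerDl addr_ge0 ?mnorm_ge0 //; exact: hu.
have mB : mnorm v (B i) <= Q.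
  apply: le_trans (QA i); rewrite addrAC lerDr addr_ge0 ?mnorm_ge0 //; exact: hu.
have mC : mnorm v (C i * E) <= Q.
  by apply: le_trans (QA i); rewrite lerDr addr_ge0 ?mnorm_ge0 //; exact: hu.
have hCE : C i * E \is N.-homog by have := dhomogM hCi hE; rewrite subnK.
have bnd d (P : {mpoly K[3]}) : P \is d.-homog -> (d <= N)%N -> mnorm v P <= Q ->
    gn r (mmap polyC p P) <= Q * X ^+ N.
  move=> hP dN hQ; apply: le_trans (gauss_mmap_le r0 (ltW X0) hp hP) _.
  apply: ler_pM => //; rewrite ?exprn_ge0 ?mnorm_ge0 //; [exact: hu|exact: ltW|].
  exact: ler_weXn2l.
have := congr1 (gn r \o mmap polyC p) eq_i; rewrite /= -mpolyXn !rmorphD !rmorphM /=.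
rewrite rmorphXn /= !mmapX mmap1U mmap1U (ultraX hg) hi => eX.
have : X ^+ N.+1 <= Num.max (Q * X ^+ N * c0) (Q * X ^+ N * gn r (p oz)).
  rewrite eX; apply: (ultraD_le hg); last first.
    have -> : mmap polyC p (C i) * (p oz * mmap polyC p E) =
       mmap polyC p (C i * E) * p oz by rewrite rmorphM mulrCA [RHS]mulrC.
    rewrite (ultraM hg) le_max; apply/orP; right; apply: ler_wpM2r.
      exact: gauss_norm_ge0.
    exact: bnd hCE _ _.
  apply: (ultraD_le hg); rewrite (ultraM hg) le_max; apply/orP; left.
    apply: ler_pM => //; try exact: gauss_norm_ge0.
    by apply: bnd hAi _ _ => //; exact: leq_subS.
  apply: ler_pM => //; try exact: gauss_norm_ge0.
  by apply: bnd hBi _ _ => //; exact: leq_subS.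
move=> hX; have {hX} : X <= Q * Num.max c0 (gn r (p oz)).
  have XN : 0 < X ^+ N by rewrite exprn_gt0.
  rewrite -(ler_pM2r XN) -exprS; apply: le_trans hX _.
  rewrite ge_max ![Q * X ^+ N * _]mulrAC !ler_pM2r // !ler_pM2l //.
  by rewrite !le_max !lexx orbT.
rewrite ler_pdivrMl // maxr_pMr ?(ltW Q0) // le_max => /orP[|//] h.
by move: MX; rewrite leNgt => /negP; case; apply: le_lt_trans h _; rewrite ltrDr.
Qed.

(** By [asymptotic_factor] the product of the p_e - c p_z over c in s is small
    compared with X^(size s), so one of the factors is small compared with X. *)
Lemma near_curve_factor e : exists s : seq K, forall k eps, 0 < k -> 0 < eps ->
  exists M, forall r p X, near_curve r p X -> M <= X -> k * X <= gn r (p oz) ->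
  exists2 c, c \in s & gn r (p e - c *: p oz) <= eps * X.
Proof.
have [s [N [A [B [hN1 hN2 hA hB eq_s]]]]] := asymptotic_factor e hd h1 h2 nd.
exists s => k eps k0 eps0.
pose Q := mnorm v A + mnorm v B.
have mA0 : 0 <= mnorm v A by apply: mnorm_ge0; exact: hu.
have mB0 : 0 <= mnorm v B by apply: mnorm_ge0; exact: hu.
have Q0 : 0 <= Q by exact: addr_ge0.
pose L := eps ^+ size s * k ^+ N.
have L0 : 0 < L by rewrite mulr_gt0 ?exprn_gt0.
exists (1 + Q * c0 / L) => r p X [r0 hp _ hc1 hc2] MX kX.
have q0 : 0 <= Q * c0 / L by rewrite !mulr_ge0 ?invr_ge0 // ltW.
have X1 : 1 <= X by apply: le_trans MX; rewrite lerDl.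
have X0 : 0 < X by exact: lt_le_trans ltr01 X1.
have hg := gauss_ultranorm hu r0.
have [/hasP[c cs hc]|/hasPn no] := boolP (has (fun c => gn r (p e - c *: p oz) <= eps * X) s).
  by exists c.
exfalso; pose n := (size s + N).-1.
have nS : (size s + N = n.+1)%N.
  by rewrite /n prednK // addn_gt0 orbC (leq_trans d1_gt0).
have bnd d (P : {mpoly K[3]}) : P \is d.-homog -> (d <= n)%N ->
    gn r (mmap polyC p P) <= mnorm v P * X ^+ n.
  move=> hP dn; apply: le_trans (gauss_mmap_le r0 (ltW X0) hp hP) _.
  apply: ler_wpM2l; first by apply: mnorm_ge0; exact: hu.
  exact: ler_weXn2l.
have up : gn r (mmap polyC p (A * F1 + B * F2)) <= Q * X ^+ n * c0.
  have X0' := exprn_ge0 n (ltW X0).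
  rewrite rmorphD !rmorphM /=; apply: (ultraD_le hg); rewrite (ultraM hg).
    apply: ler_pM => //; try exact: gauss_norm_ge0.
    apply: le_trans (bnd _ _ hA _) _; first by rewrite nS leq_subS.
    by apply: ler_wpM2r => //; rewrite lerDl.
  apply: ler_pM => //; try exact: gauss_norm_ge0.
  apply: le_trans (bnd _ _ hB _) _; first by rewrite nS leq_subS.
  by apply: ler_wpM2r => //; rewrite lerDr.
have : (eps * X) ^+ size s * (k * X) ^+ N <= Q * X ^+ n * c0.
  apply: le_trans up; rewrite -eq_s rmorphM rmorphXn rmorph_prod /= (ultraM hg).
  rewrite (ultraX hg) (ultra_prod hg) mmapX mmap1U.
  have eX0 : 0 <= eps * X by rewrite mulr_ge0 // ltW.
  have kX0 : 0 <= k * X by rewrite mulr_ge0 // ltW.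
  apply: ler_pM; [exact: exprn_ge0 | exact: exprn_ge0 | | ]; last first.
    by apply: lerXn2r; rewrite ?nnegrE ?gauss_norm_ge0 // mulr_ge0 // ltW.
  have -> : (eps * X) ^+ size s = \prod_(c <- s) (eps * X).
    by rewrite big_const_seq count_predT iter_mulr_1.
  rewrite big_seq [leRHS]big_seq.
  apply: ler_prod => c cs; rewrite eX0 /=.
  rewrite rmorphB rmorphM /= !mmapX !mmap1U mmapC mul_polyC.
  by have := no c cs; rewrite -ltNge => /ltW.
rewrite !exprMn.
have -> : eps ^+ size s * X ^+ size s * (k ^+ N * X ^+ N) = L * X * X ^+ n.
  by rewrite -[RHS]mulrA -exprS -nS exprD /L mulrACA.
have -> : Q * X ^+ n * c0 = Q * c0 * X ^+ n by ring.
rewrite ler_pM2r ?exprn_gt0 // mulrC -ler_pdivlMr // leNgt => /negP; apply.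
by apply: lt_le_trans MX; rewrite ltrDr.
Qed.

Let alpha (a : 'I_3 -> K) : R := 1 + \sum_i v (a i).

Lemma alpha_ge1 a : 1 <= alpha a.
Proof. by rewrite lerDl sumr_ge0 // => i _; exact: (ultra_ge0 hu). Qed.

Lemma taylor_near d (F : {mpoly K[3]}) a r p X Y : (0 < d)%N -> F \is d.-homog ->
  0 < r -> (forall i, gn r (p i) <= X) -> 0 < Y -> Y <= X ->
  (forall i, gn r (p i - a i *: p oz) <= Y) ->
  let Fp := mmap polyC p F in
  let L := \sum_i (F^`M(i)).@[a]%:P * (p i - a i *: p oz) in
  let Q := mnorm v F * (alpha a * X) ^+ d in
  let th := Y / (alpha a * X) in
  gn r (Fp - p oz ^+ d * (F.@[a])%:P) <= Q * th /\
  gn r (Fp - p oz ^+ d * (F.@[a])%:P - p oz ^+ d.-1 * L) <= Q * th ^+ 2.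
Proof.
move=> d0 hF r0 hp Y0 YX hy Fp L Q th.
have X0 : 0 < X by exact: lt_le_trans YX.
have hg := gauss_ultranorm hu r0.
have a0 : 0 < alpha a by exact: lt_le_trans ltr01 (alpha_ge1 a).
have -> : Fp = mmap polyC (fun i => p oz * (a i)%:P + (p i - a i *: p oz)) F.
  by apply: eq_mmap => [c|i] //; rewrite mulrC mul_polyC addrC subrK.
apply: (taylor_estimate hg (fun c => gauss_normC hu r c)) => //.
  by apply: le_trans YX _; rewrite ler_peMl ?alpha_ge1 // ltW.
move=> i; rewrite (ultraM hg) (gauss_normC hu) mulrC.
apply: ler_pM => //; rewrite ?(ultra_ge0 hu) ?gauss_norm_ge0 //.
rewrite /alpha (bigD1 i) //= addrCA lerDl addr_ge0 // sumr_ge0 // => j _.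
exact: (ultra_ge0 hu).
Qed.

(** If F(a) <> 0, then p near p_z a would give F(p) the size of X^d. *)
Lemma near_curve_value d (F : {mpoly K[3]}) a k : (0 < d)%N -> F \is d.-homog ->
  0 < k -> F.@[a] != 0 ->
  exists eps M, 0 < eps /\ forall r p X, 0 < r -> (forall i, gn r (p i) <= X) ->
  gn r (mmap polyC p F) <= c0 -> M <= X -> k * X <= gn r (p oz) ->
  ~ forall i, gn r (p i - a i *: p oz) <= eps * X.
Proof.
move=> d0 hF k0 Fa.
have m0 : 0 <= mnorm v F by apply: mnorm_ge0; exact: hu.
have a1 := alpha_ge1 a; have a0 := lt_le_trans ltr01 a1.
have vF := ultra_gt0 hu Fa.
pose c := k ^+ d * v F.@[a]; have c_gt0 : 0 < c by rewrite mulr_gt0 ?exprn_gt0.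
pose q := mnorm v F * alpha a ^+ d; have q0 : 0 <= q by rewrite mulr_ge0 ?exprn_ge0 // ltW.
pose eps := Num.min 1 (c / (q + 1) / 2).
have q1 : 0 < q + 1 by rewrite ltr_wpDl.
have eps0 : 0 < eps by rewrite lt_min ltr01 !divr_gt0.
exists eps, (1 + c0 / c); split=> // r p X r0 hp hc MX kX hy.
have c0c : 0 <= c0 / c by rewrite divr_ge0 // ltW.
have X1 : 1 <= X by apply: le_trans MX; rewrite lerDl.
have X0 : 0 < X by exact: lt_le_trans ltr01 X1.
have eX : eps * X <= X by rewrite ger_pMl // ge_min lexx.
have hg := gauss_ultranorm hu r0.
have [+ _] := taylor_near d0 hF r0 hp (mulr_gt0 eps0 X0) eX hy.
set Fp := mmap _ _ _; set P0 := p oz ^+ d * _ => h.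
have hP0 : c * X ^+ d <= gn r P0.
  rewrite (ultraM hg) (gauss_normC hu) (ultraX hg) /c mulrAC -exprMn.
  apply: ler_wpM2r; first exact: ltW.
  by apply: lerXn2r; rewrite ?nnegrE ?gauss_norm_ge0 // mulr_ge0 // ltW.
have Xd : X <= X ^+ d by rewrite -[leLHS]expr1; exact: ler_weXn2l.
have : gn r P0 < c * X ^+ d; last by rewrite ltNge hP0.
rewrite -(subrK Fp P0); apply: (ultraD_lt hg).
  rewrite (ultraBC hg); apply: le_lt_trans h _.
  have -> : mnorm v F * (alpha a * X) ^+ d * (eps * X / (alpha a * X)) =
     q * eps / alpha a * X ^+ d.
    by rewrite exprMn /q; field; rewrite !gt_eqF.
  rewrite ltr_pM2r ?exprn_gt0 // ltr_pdivrMr //.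
  apply: (@lt_le_trans _ _ c); last by rewrite ler_peMr // ltW.
  apply: (@le_lt_trans _ _ (q * (c / (q + 1) / 2))).
    by apply: ler_wpM2l => //; rewrite ge_min lexx orbT.
  have -> : q * (c / (q + 1) / 2) = (q / (q + 1) / 2) * c by ring.
  rewrite gtr_pMl //; have : q / (q + 1) <= 1 by rewrite ler_pdivrMr // mul1r lerDl.
  lra.
apply: le_lt_trans hc _; apply: lt_le_trans (_ : c * X <= _); last by rewrite ler_pM2l.
by rewrite mulrC -ltr_pdivrMr //; apply: lt_le_trans MX; rewrite ltrDr.
Qed.

(** If F(a) = 0, the first order term of F(p) is dF(a) applied to the error
    p - p_z a; the second order remainder carries an additional factor eps. *)
Lemma near_curve_gradient d (F : {mpoly K[3]}) a : (0 < d)%N -> F \is d.-homog ->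
  F.@[a] = 0 -> exists2 q, 0 <= q & forall r p X Y eps, 0 < r ->
  (forall i, gn r (p i) <= X) -> gn r (mmap polyC p F) <= c0 ->
  0 < Y -> Y <= X -> Y <= eps * X -> (forall i, gn r (p i - a i *: p oz) <= Y) ->
  gn r (p oz) ^+ d.-1 * gn r (\sum_i (F^`M(i)).@[a]%:P * (p i - a i *: p oz)) <=
  Num.max c0 (q * eps * (X ^+ d.-1 * Y)).
Proof.
move=> d0 hF Fa.
have m0 : 0 <= mnorm v F by apply: mnorm_ge0; exact: hu.
have a1 := alpha_ge1 a; have a0 := lt_le_trans ltr01 a1.
exists (mnorm v F * alpha a ^+ d).
  by rewrite mulr_ge0 ?exprn_ge0 // ltW.
move=> r p X Y eps r0 hp hc Y0 YX Ye hy.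
have X0 : 0 < X by exact: lt_le_trans YX.
have hg := gauss_ultranorm hu r0.
have [_] := taylor_near d0 hF r0 hp Y0 YX hy.
set Fp := mmap _ _ _; set L := \sum_i _.
rewrite Fa mulr0 subr0 => h.
rewrite -(ultraX hg) -(ultraM hg) -(subrK Fp (_ * L)).
apply: (ultraD_le hg); last by rewrite le_max hc.
rewrite (ultraBC hg) le_max; apply/orP; right; apply: le_trans h _.
have -> : mnorm v F * (alpha a * X) ^+ d * (Y / (alpha a * X)) ^+ 2 =
   mnorm v F * alpha a ^+ d * (X ^+ d.-1 * Y) * (Y / X) / alpha a ^+ 2.
  by rewrite -(prednK d0) /= !exprS !exprMn; field; rewrite !gt_eqF.
rewrite ler_pdivrMr ?exprn_gt0 //.
have Yx : Y / X <= eps by rewrite ler_pdivrMr.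
have e0 : 0 <= eps by apply: le_trans Yx; rewrite divr_ge0 // ltW.
have t0 : 0 <= mnorm v F * alpha a ^+ d * (X ^+ d.-1 * Y).
  by rewrite !mulr_ge0 ?exprn_ge0 // ltW.
apply: le_trans (ler_wpM2l t0 Yx) _.
have -> : mnorm v F * alpha a ^+ d * (X ^+ d.-1 * Y) * eps =
  mnorm v F * alpha a ^+ d * eps * (X ^+ d.-1 * Y) by ring.
by apply: ler_peMr; rewrite ?exprn_ege1 // !mulr_ge0 ?exprn_ge0 // ltW.
Qed.

Lemma generic_pair_regular a : a oz = 1 -> F1.@[a] = 0 -> F2.@[a] = 0 ->
  (degeneracy d1 d2 F1 F2).@[a] != 0.
Proof.
move=> az Fa1 Fa2; have [N [_ _ _ hN]] := nd.
have [|A [B [C [_ _ _ E]]]] := hN (U_(oz) *+ N.+1)%MM.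
  by rewrite mdegMn mdeg1 mul1n.
apply/eqP => h; move: E h; move: (degeneracy d1 d2 F1 F2) => T E h.
have := congr1 (meval a) E; rewrite -mpolyXn rmorphXn /=.
rewrite !rmorphD !rmorphM /= mevalXU az Fa1 Fa2 h expr1n !mulr0 !addr0.
by move/eqP; rewrite oner_eq0.
Qed.

(** The alternative between a bounded Y and a Y that dominates its own bound;
    the second is excluded by the smallness of eps. *)
Lemma gap_bound (b g q eps W Y : R) :
  0 < b -> 0 <= g -> 0 <= q -> 1 <= W -> 0 < Y -> g * q * eps < b ->
  b * (W * Y) <= g * Num.max c0 (q * eps * (W * Y)) -> Y <= g * c0 / b.
Proof.
move=> b0 g0 q0 W1 Y0 small.
have W0 : 0 < W by exact: lt_le_trans W1.
have WY : 0 < W * Y by rewrite mulr_gt0.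
rewrite maxr_pMr // le_max => /orP[h|]; last first.
  by rewrite !mulrA -mulrA -[leRHS]mulrA ler_pM2r // leNgt small.
rewrite ler_pdivlMr //; apply: le_trans h; rewrite mulrC ler_pM2l //.
by apply: ler_peMl => //; exact: ltW.
Qed.

(** By transversality the error p - p_z a is recovered by Cramer's rule from the
    two first order terms of [near_curve_gradient], so it is bounded. *)
Lemma near_curve_point a k : a oz = 1 -> 0 < k -> exists eps M, 0 < eps /\
  forall r p X, near_curve r p X -> M <= X -> k * X <= gn r (p oz) ->
  (forall i, gn r (p i - a i *: p oz) <= eps * X) ->
  [/\ F1.@[a] = 0, F2.@[a] = 0 & forall i, gn r (p i - a i *: p oz) <= M].
Proof.
move=> az k0.
have [Fa1|] := eqVneq F1.@[a] 0; last first.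
  move=> /(near_curve_value d1_gt0 h1 k0)[eps [M [eps0 hM]]]; exists eps, M; split=> //.
  by move=> r p X [r0 hp _ hc1 _] MX kX /(hM r p X r0 hp hc1 MX kX).
have [Fa2|] := eqVneq F2.@[a] 0; last first.
  move=> /(near_curve_value d2_gt0 h2 k0)[eps [M [eps0 hM]]]; exists eps, M; split=> //.
  by move=> r p X [r0 hp _ _ hc2] MX kX /(hM r p X r0 hp hc2 MX kX).
pose A1 := (F1^`M(ox)).@[a]; pose B1 := (F1^`M(oy)).@[a].
pose A2 := (F2^`M(ox)).@[a]; pose B2 := (F2^`M(oy)).@[a].
pose D := A1 * B2 - B1 * A2.
have D0 : D != 0.
  have := generic_pair_regular az Fa1 Fa2.
  rewrite /degeneracy !mevalM !mulf_eq0 !negb_or => /andP[/andP[+ _] _].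
  by rewrite /jac mevalB !mevalM.
have vD := ultra_gt0 hu D0.
pose g := v A1 + v A2 + v B1 + v B2.
have g0 : 0 <= g by rewrite !addr_ge0 ?(ultra_ge0 hu).
have [q1 q1_ge0 hq1] := near_curve_gradient d1_gt0 h1 Fa1.
have [q2 q2_ge0 hq2] := near_curve_gradient d2_gt0 h2 Fa2.
pose b1 := k ^+ d1.-1 * v D; pose b2 := k ^+ d2.-1 * v D.
have b1_gt0 : 0 < b1 by rewrite mulr_gt0 ?exprn_gt0.
have b2_gt0 : 0 < b2 by rewrite mulr_gt0 ?exprn_gt0.
pose e1 := b1 / (g * q1 + 1) / 2; pose e2 := b2 / (g * q2 + 1) / 2.
have gq1 : 0 < g * q1 + 1 by rewrite ltr_wpDl // mulr_ge0.
have gq2 : 0 < g * q2 + 1 by rewrite ltr_wpDl // mulr_ge0.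
have small q b : 0 <= q -> 0 < b -> forall eps, eps <= b / (g * q + 1) / 2 ->
    g * q * eps < b.
  move=> q0 b0 eps he; have gq : 0 <= g * q by rewrite mulr_ge0.
  apply: le_lt_trans (ler_wpM2l gq he) _.
  have -> : g * q * (b / (g * q + 1) / 2) = (g * q / (g * q + 1) / 2) * b by ring.
  rewrite gtr_pMl //.
  have : g * q / (g * q + 1) <= 1 by rewrite ler_pdivrMr ?mul1r ?lerDl // ltr_wpDl.
  lra.
pose eps := Num.min 1 (Num.min e1 e2).
have eps0 : 0 < eps by rewrite !lt_min ltr01 !divr_gt0.
exists eps, (1 + g * c0 / b1 + g * c0 / b2); split=> //.
have t1 : 0 <= g * c0 / b1 by rewrite !mulr_ge0 ?invr_ge0 // ltW.
have t2 : 0 <= g * c0 / b2 by rewrite !mulr_ge0 ?invr_ge0 // ltW.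
move=> r p X [r0 hp _ hc1 hc2] MX kX hy; split=> //.
have hg := gauss_ultranorm hu r0.
have X1 : 1 <= X by apply: le_trans MX; rewrite -addrA lerDl addr_ge0.
have X0 : 0 < X by exact: lt_le_trans ltr01 X1.
pose y i := p i - a i *: p oz.
have yz : y oz = 0 by rewrite /y az scale1r subrr.
pose Y := Num.max (gn r (y ox)) (gn r (y oy)).
have hY : forall i, gn r (y i) <= Y.
  apply: ord3P; rewrite ?yz ?(ultra0 hg) le_max ?lexx ?orbT //.
  by rewrite gauss_norm_ge0.
suff YM : Y <= 1 + g * c0 / b1 + g * c0 / b2 by move=> i; exact: le_trans (hY i) YM.
have YeX : Y <= eps * X by rewrite ge_max !hy.
have [Y0|Y0] := ltP 0 Y; last by apply: le_trans Y0 _; rewrite !addr_ge0.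
have YX : Y <= X by apply: le_trans YeX _; rewrite ger_pMl // ge_min lexx.
have := hq1 r p X Y eps r0 hp hc1 Y0 YX YeX hY.
have := hq2 r p X Y eps r0 hp hc2 Y0 YX YeX hY.
rewrite !sum_ord3 -/(y ox) -/(y oy) -/(y oz) yz !mulr0 !addr0 -/A1 -/A2 -/B1 -/B2.
set L2 := A2%:P * _ + _; set L1 := A1%:P * _ + _ => hL2 hL1.
have cramer z : (z = y ox \/ z = y oy) ->
    v D * gn r z <= g * Num.max (gn r L1) (gn r L2).
  have gL i c : v c <= g -> (i = L1 \/ i = L2) ->
      gn r (c%:P * i) <= g * Num.max (gn r L1) (gn r L2).
    move=> hc hi; rewrite (ultraM hg) (gauss_normC hu).
    apply: ler_pM; rewrite ?(ultra_ge0 hu) ?gauss_norm_ge0 //.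
    by case: hi => ->; rewrite le_max lexx ?orbT.
  have v0 := ultra_ge0 hu.
  have [lA1 lA2 lB1 lB2] := le_sum4 (v0 A1) (v0 A2) (v0 B1) (v0 B2).
  rewrite -(gauss_normC hu r D) -(ultraM hg) => -[] ->.
    have -> : D%:P * y ox = B2%:P * L1 - B1%:P * L2.
      by rewrite /D /L1 /L2 polyCB !polyCM; ring.
    by apply: (ultraB_le hg); apply: gL; auto.
  have -> : D%:P * y oy = A1%:P * L2 - A2%:P * L1.
    by rewrite /D /L1 /L2 polyCB !polyCM; ring.
  by apply: (ultraB_le hg); apply: gL; auto.
have {cramer} : v D * Y <= g * Num.max (gn r L1) (gn r L2).
  by rewrite /Y maxr_pMr ?(ultra_ge0 hu) // ge_max !cramer; auto.
have fin d q b L : b = k ^+ d.-1 * v D -> 0 <= q -> eps <= b / (g * q + 1) / 2 ->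
    0 < b -> gn r (p oz) ^+ d.-1 * gn r L <= Num.max c0 (q * eps * (X ^+ d.-1 * Y)) ->
    v D * Y <= g * gn r L -> Y <= g * c0 / b.
  move=> bE q0 he b0 hL hDY.
  apply: (@gap_bound b g q eps (X ^+ d.-1)) => //.
  - exact: exprn_ege1.
  - exact: small.
  apply: le_trans (ler_wpM2l g0 hL).
  rewrite [leRHS]mulrCA; apply: le_trans (_ : (k * X) ^+ d.-1 * (v D * Y) <= _).
    by rewrite bE exprMn le_eqVlt; apply/orP; left; apply/eqP; ring.
  apply: ler_pM => //.
  - by rewrite exprn_ge0 // mulr_ge0 // ltW.
  - by rewrite mulr_ge0 ?(ultra_ge0 hu) // ltW.
  - by apply: lerXn2r; rewrite ?nnegrE ?gauss_norm_ge0 // mulr_ge0 // ltW.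
have em1 : eps <= e1 by rewrite /eps !ge_min lexx !orbT.
have em2 : eps <= e2 by rewrite /eps !ge_min lexx !orbT.
rewrite [g * _]maxr_pMr // le_max => /orP[/(fin d1 q1 b1 L1 erefl q1_ge0 em1 b1_gt0 hL1)|
  /(fin d2 q2 b2 L2 erefl q2_ge0 em2 b2_gt0 hL2)] h; apply: le_trans h _.
  by rewrite addrAC lerDr addr_ge0.
by rewrite lerDr addr_ge0.
Qed.

Lemma uniform_constants (T : eqType) (l : seq T) (Q : T -> R -> R -> Prop) :
  (forall c, exists eps M, 0 < eps /\ Q c eps M) ->
  exists eps M, 0 < eps /\
    forall c, c \in l -> exists e M', [/\ eps <= e, M' <= M & Q c e M'].
Proof.
move=> hQ; elim: l => [|c l [eps [M [eps0 hl]]]]; first by exists 1, 0.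
have [e [N [e0 hc]]] := hQ c.
exists (Num.min e eps), (Num.max N M); split=> [|c']; first by rewrite lt_min e0.
rewrite inE => /orP[/eqP->|/hl[e' [M' [h1' h2' h3']]]].
  by exists e, N; rewrite ge_min le_max !lexx.
by exists e', M'; rewrite ge_min le_max h1' h2' !orbT.
Qed.

Definition affine_pt (c : K * K) (i : 'I_3) : K :=
  if i == ox then c.1 else if i == oy then c.2 else 1.

(** [near_curve_factor] for X_ox and X_oy leaves finitely many points, and
    [near_curve_point] applies to each of them with its own constants. *)
Lemma near_curve_asymptote : exists (l : seq (K * K)) (k M : R), 0 < k /\
  forall r p X, near_curve r p X -> M <= X -> k * X <= gn r (p oz) /\
  exists2 c, c \in l & let a := affine_pt c in
  [/\ F1.@[a] = 0, F2.@[a] = 0 & forall i, gn r (p i - a i *: p oz) <= M].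
Proof.
have [k [M0 [k0 _ hk]]] := near_curve_oz.
have [sx hx] := near_curve_factor ox; have [sy hy] := near_curve_factor oy.
pose l := [seq (c, c') | c <- sx, c' <- sy].
have [eps [M1 [eps0 hl]]] := @uniform_constants _ l _ (fun c : K * K =>
  @near_curve_point (affine_pt c) k erefl k0).
have [Mx hMx] := hx k eps k0 eps0; have [My hMy] := hy k eps k0 eps0.
exists l, k, (Num.max (Num.max M0 M1) (Num.max Mx My)); split=> // r p X nc.
rewrite !ge_max => /andP[/andP[MX0 MX1] /andP[MXx MXy]].
have kX := hk r p X nc MX0; split=> //.
have [c cs hc] := hMx r p X nc MXx kX; have [c' cs' hc'] := hMy r p X nc MXy kX.
have ccl : (c, c') \in l by apply/allpairsP; exists (c, c').
exists (c, c') => //=; have [e [M' [he hM' hp]]] := hl _ ccl.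
have [r0 _ _ _ _] := nc; have hg := gauss_ultranorm hu r0.
have X0 : 0 <= X.
  by have [_ hpX _ _ _] := nc; exact: le_trans (gauss_norm_ge0 _ _ _) (hpX ox).
have [||Fa1 Fa2 hb] := hp r p X nc _ kX.
- exact: le_trans hM' MX1.
- apply: ord3P => /=.
  + by apply: le_trans hc _; apply: ler_wpM2r.
  + by apply: le_trans hc' _; apply: ler_wpM2r.
  + by rewrite scale1r subrr (ultra0 hg) mulr_ge0 // (le_trans (ltW eps0)).
by split=> // i; apply: le_trans (hb i) _; rewrite !le_max hM' orbT.
Qed.

End Estimates.

(** * Power series and convergence *)

Section Limits.
Context (R : realType) (K : fieldType) (v : K -> R).
Context (hv : nonarch_absolute_value v).
Local Notation hu := (absv_ultranorm hv).

Lemma absv_cvg_unique u l l' : absv_cvg v u l -> absv_cvg v u l' -> l = l'.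
Proof.
move=> /(absv_cvgP _ _ hv) h /(absv_cvgP _ _ hv) h'; apply/eqP; rewrite -subr_eq0; apply/negP => /negP ne.
have e0 := ultra_gt0 hu ne.
have [N hN] := h _ e0; have [N' hN'] := h' _ e0.
have n1 := hN (N + N')%N (leq_addr _ _); have n2 := hN' (N + N')%N (leq_addl _ _).
have := ultraB_lt hu n2 n1.
have -> : u (N + N')%N - l' - (u (N + N')%N - l) = l - l' by ring.
by rewrite ltxx.
Qed.

Lemma absv_cvg_eventually u w l N : absv_cvg v u l ->
  (forall n, (N <= n)%N -> w n = u n) -> absv_cvg v w l.
Proof.
move=> /(absv_cvgP _ _ hv) h uw; apply/(absv_cvgP _ _ hv) => e /h[N' hN'].
exists (N + N')%N => n hn; rewrite uw ?(leq_trans (leq_addr _ _) hn) // hN' //.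
exact: leq_trans (leq_addl _ _) hn.
Qed.

Lemma absv_cvg_cst c : absv_cvg v (fun=> c) c.
Proof. by apply/(absv_cvgP _ _ hv) => e e0; exists 0%N => n _; rewrite subrr (ultra0 hu). Qed.

Lemma absv_cvgD u w l m : absv_cvg v u l -> absv_cvg v w m ->
  absv_cvg v (fun n => u n + w n) (l + m).
Proof.
move=> /(absv_cvgP _ _ hv) h /(absv_cvgP _ _ hv) h'; apply/(absv_cvgP _ _ hv) => e e0.
have [N hN] := h _ e0; have [N' hN'] := h' _ e0; exists (N + N')%N => n hn.
rewrite opprD addrACA; apply: (ultraD_lt hu); [apply: hN|apply: hN'].
  exact: leq_trans (leq_addr _ _) hn.
exact: leq_trans (leq_addl _ _) hn.
Qed.

Lemma absv_cvgM u w l m : absv_cvg v u l -> absv_cvg v w m ->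
  absv_cvg v (fun n => u n * w n) (l * m).
Proof.
move=> /(absv_cvgP _ _ hv) h /(absv_cvgP _ _ hv) h'; apply/(absv_cvgP _ _ hv) => e e0.
pose M := 1 + v l + v m.
have [vl vm] := (ultra_ge0 hu l, ultra_ge0 hu m).
have M0 : 0 < M by rewrite /M -addrA ltr_pwDl // addr_ge0.
have [N hN] := h _ (divr_gt0 e0 M0); have [N' hN'] := h' _ (divr_gt0 e0 M0).
have [N1 hN1] := h _ ltr01; exists (N + N' + N1)%N => n hn.
have n1 : (N <= n)%N by apply: leq_trans hn; rewrite -addnA leq_addr.
have n2 : (N' <= n)%N by apply: leq_trans hn; rewrite addnAC leq_addl.
have n3 : (N1 <= n)%N by apply: leq_trans hn; rewrite leq_addl.
have -> : u n * w n - l * m = u n * (w n - m) + (u n - l) * m by ring.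
have uM : v (u n) <= M.
  rewrite -(subrK l (u n)); apply: (ultraD_le hu).
    by apply: le_trans (ltW (hN1 n n3)) _; rewrite /M -addrA lerDl addr_ge0.
  by rewrite /M; lra.
have mM : v m <= M by rewrite /M; lra.
apply: (ultraD_lt hu); rewrite (ultraM hu).
  have := hN' n n2; rewrite ltr_pdivlMr // => h1.
  by apply: le_lt_trans h1; rewrite mulrC; apply: ler_wpM2l (ultra_ge0 hu _) _ _ uM.
have := hN n n1; rewrite ltr_pdivlMr // => h1.
by apply: le_lt_trans h1; apply: ler_wpM2l (ultra_ge0 hu _) _ _ mM.
Qed.

Lemma absv_cvg_meval n (F : {mpoly K[n]}) (u : nat -> 'I_n -> K) l :
  (forall i, absv_cvg v (u^~ i) (l i)) -> absv_cvg v (fun k => F.@[u k]) F.@[l].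
Proof.
move=> ul; elim/mpoly_alg_ind: F => [c|i|p q hp hq|p q hp hq].
- rewrite mevalC (_ : (fun k => _) = fun=> c); first exact: absv_cvg_cst.
  by apply/funext => k; rewrite mevalC.
- rewrite mevalXU (_ : (fun k => _) = u^~ i) //.
  by apply/funext => k; rewrite mevalXU.
- rewrite mevalD (_ : (fun k => _) = fun k => p.@[u k] + q.@[u k]).
    exact: absv_cvgD.
  by apply/funext => k; rewrite mevalD.
- rewrite mevalM (_ : (fun k => _) = fun k => p.@[u k] * q.@[u k]).
    exact: absv_cvgM.
  by apply/funext => k; rewrite mevalM.
Qed.

(** Convergence is given at points of K only. If some z has |z| > 1, its powers
    exceed every real r; otherwise the absolute value is trivial, and the
    convergence at 1 makes almost all coefficients vanish. *)
Lemma entire_coef (a : nat -> K) (g : K -> K) :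
  (forall z, absv_cvg v (fun n => \sum_(i < n) a i * z ^+ i) (g z)) ->
  forall r e, 0 < r -> 0 < e -> exists N, forall n, (N <= n)%N -> v (a n) * r ^+ n < e.
Proof.
move=> hg r e r0 e0.
have term z e' : 0 < e' -> exists N, forall n, (N <= n)%N -> v (a n) * v z ^+ n < e'.
  move=> e'0; have /(absv_cvgP _ _ hv)/(_ _ e'0)[N hN] := hg z; exists N => n hn.
  have := ultraB_lt hu (hN n.+1 (leqW hn)) (hN n hn).
  have -> : forall x y l : K, x - l - (y - l) = x - y by move=> *; ring.
  by rewrite big_ord_recr /= addrAC subrr add0r (ultraM hu) (ultraX hu).
have [[z hz]|no] := pselect (exists z, 1 < v z).
  have [k hk] : exists k, r <= v z ^+ k.
    have [k hk] : exists k, r / (v z - 1) < k%:R.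
      exists (Num.bound (r / (v z - 1))); apply: archi_boundP.
      by rewrite divr_ge0 ?subr_ge0 // ltW.
    exists k; move: hk; rewrite ltr_pdivrMr ?subr_gt0 // => hk.
    apply: le_trans (ltW hk) _; elim: k {hk} => [|k IH].
      by rewrite mul0r expr0 ler01.
    have z1 : 1 <= v z ^+ k by apply: exprn_ege1; exact: ltW.
    have := ler_wpM2l (_ : 0 <= v z - 1) z1; rewrite subr_ge0 ltW // => /(_ erefl).
    by rewrite exprS -natr1; lra.
  have [N hN] := term (z ^+ k) e e0; exists N => n hn; apply: le_lt_trans (hN n hn).
  apply: ler_wpM2l; first exact: (ultra_ge0 hu).
  by rewrite (ultraX hu); apply: lerXn2r; rewrite ?nnegrE ?exprn_ge0 ?(ultra_ge0 hu) // ltW.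
have [N hN] := term 1 1 ltr01; exists N => n hn.
have := hN n hn; rewrite (ultra1 hu) expr1n mulr1 => a1.
have [->|an] := eqVneq (a n) 0; first by rewrite (ultra0 hu) mul0r.
exfalso; apply: no; exists (a n)^-1.
have va := ultra_gt0 hu an.
by rewrite -(ltr_pM2l va) mulr1 -(ultraM hu) divff // (ultra1 hu).
Qed.

End Limits.

Lemma leq_add4 a b c d x : (a + b + c + d <= x)%N ->
  [/\ (a <= x)%N, (b <= x)%N, (c <= x)%N & (d <= x)%N].
Proof. by move=> h; split; lia. Qed.

Section GaussCauchy.
Context (R : realType) (K : closedFieldType) (v : K -> R).
Context (hv : nonarch_absolute_value v).
Local Notation hu := (absv_ultranorm hv).
Local Notation gn := (gauss_norm v).

Lemma truncation_cauchy (a : nat -> K) :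
  (forall r e, 0 < r -> 0 < e -> exists N, forall n, (N <= n)%N -> v (a n) * r ^+ n < e) ->
  gauss_cauchy v (fun n => \poly_(i < n) a i).
Proof.
move=> ha r e r0 e0; have [N hN] := ha r e r0 e0; exists N => m n hm hn.
apply: gauss_norm_lt => // i; rewrite coefB !coef_poly.
case: (ltnP i N) => [iN|Ni].
  by rewrite !(leq_trans iN) // subrr (ultra0 hu) mul0r.
have z0 : v 0 * r ^+ i < e by rewrite (ultra0 hu) mul0r.
have hi := hN i Ni.
by do 2 case: ifP => _; rewrite ?subr0 ?sub0r ?subrr ?oppr0 ?(ultraN hu).
Qed.

Lemma gauss_cauchy_cst p : gauss_cauchy v (fun=> p).
Proof.
move=> r e r0 e0; exists 0%N => m n _ _.
by rewrite subrr (ultra0 (gauss_ultranorm hu r0)).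
Qed.

Lemma gauss_cauchyD h h' : gauss_cauchy v h -> gauss_cauchy v h' ->
  gauss_cauchy v (fun n => h n + h' n).
Proof.
move=> hh hh' r e r0 e0; have [N hN] := hh r e r0 e0; have [N' hN'] := hh' r e r0 e0.
exists (N + N')%N => m n hm hn; rewrite opprD addrACA.
apply: (ultraD_lt (gauss_ultranorm hu r0)).
  by apply: hN; [apply: leq_trans hm|apply: leq_trans hn]; rewrite leq_addr.
by apply: hN'; [apply: leq_trans hm|apply: leq_trans hn]; rewrite leq_addl.
Qed.

Lemma gauss_cauchyM h h' : gauss_cauchy v h -> gauss_cauchy v h' ->
  gauss_cauchy v (fun n => h n * h' n).
Proof.
move=> hh hh' r e r0 e0; have hg := gauss_ultranorm hu r0.
have [M [N hM]] := gauss_cauchy_bounded hv r0 hh.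
have [M' [N' hM']] := gauss_cauchy_bounded hv r0 hh'.
pose B := 1 + M + M'.
have M0 : 0 <= M by apply: le_trans (hM N (leqnn _)); exact: gauss_norm_ge0.
have M'0 : 0 <= M' by apply: le_trans (hM' N' (leqnn _)); exact: gauss_norm_ge0.
have B0 : 0 < B by rewrite /B; lra.
have [N1 h1] := hh r _ r0 (divr_gt0 e0 B0); have [N2 h2] := hh' r _ r0 (divr_gt0 e0 B0).
exists (N + N' + N1 + N2)%N => m n hm hn.
have [m1 m2 m3 m4] := leq_add4 hm; have [n1 n2 n3 n4] := leq_add4 hn.
have -> : h m * h' m - h n * h' n = h m * (h' m - h' n) + (h m - h n) * h' n by ring.
apply: (ultraD_lt hg); rewrite (ultraM hg).
  have := h2 m n m4 n4; rewrite ltr_pdivlMr // => H; apply: le_lt_trans H.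
  rewrite mulrC; apply: ler_wpM2l; first exact: gauss_norm_ge0.
  by apply: le_trans (hM m m1) _; rewrite /B; lra.
have := h1 m n m3 n3; rewrite ltr_pdivlMr // => H; apply: le_lt_trans H.
apply: ler_wpM2l; first exact: gauss_norm_ge0.
by apply: le_trans (hM' n n2) _; rewrite /B; lra.
Qed.

Lemma gauss_cauchy_mmap n (F : {mpoly K[n]}) (p : nat -> 'I_n -> {poly K}) :
  (forall i, gauss_cauchy v (p^~ i)) -> gauss_cauchy v (fun k => mmap polyC (p k) F).
Proof.
move=> hp; elim/mpoly_alg_ind: F => [c|i|q q' hq hq'|q q' hq hq'].
- rewrite (_ : (fun k => _) = fun=> c%:P); first exact: gauss_cauchy_cst.
  by apply/funext => k; rewrite mmapC.
- rewrite (_ : (fun k => _) = p^~ i) //.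
  by apply/funext => k; rewrite mmapX mmap1U.
- rewrite (_ : (fun k => _) = fun k => mmap polyC (p k) q + mmap polyC (p k) q').
    exact: gauss_cauchyD.
  by apply/funext => k; rewrite rmorphD.
- rewrite (_ : (fun k => _) = fun k => mmap polyC (p k) q * mmap polyC (p k) q').
    exact: gauss_cauchyM.
  by apply/funext => k; rewrite rmorphM.
Qed.

Lemma gauss_cvg_horner h c z : gauss_cvg v h c%:P -> absv_cvg v (fun n => (h n).[z]) c.
Proof.
move=> hc; apply/(absv_cvgP _ _ hv) => e e0; pose r := Num.max 1 (v z).
have r0 : 0 < r by rewrite lt_max ltr01.
have [N hN] := hc r e r0 e0; exists N => n hn.
rewrite -[c in _ - c](hornerC c z) -hornerN -hornerD; apply: le_lt_trans (hN n hn).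
by apply: (horner_le_gauss_norm hu) => //; rewrite le_max lexx orbT.
Qed.

Lemma horner_mmap n (F : {mpoly K[n]}) (p : 'I_n -> {poly K}) z :
  (mmap polyC p F).[z] = F.@[fun i => (p i).[z]].
Proof.
rewrite -[LHS]/(horner_eval z _) mmap_rmorph; apply: eq_mmap => // c /=.
by rewrite /horner_eval hornerC.
Qed.

End GaussCauchy.

(** * Entire curves that avoid a pair in general position *)

Section Lines.
Context (K : closedFieldType).

Lemma poly_vanishing (P : {poly K}) : (forall t, P.[t] = 0) -> P = 0.
Proof.
move=> hP; have [/closed_rootP[x]|] := boolP (size (P + 1) != 1).
  by rewrite /root hornerD hP hornerC add0r oner_eq0.
rewrite negbK => /size_poly1P[c _ hc].
have PE : P = (c - 1)%:P by rewrite polyCB -hc polyC1 addrK.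
by have := hP 0; rewrite PE hornerC => ->.
Qed.

(** The hypothesis determines the polynomial F(a + s y) in s at all s <> 0; it
    is stated for s <> 0 to apply to [line_at_infinity]. *)
Lemma line_coef_eq0 d (F : {mpoly K[3]}) (a y : 'I_3 -> K) C :
  (forall s, s != 0 -> F.@[fun i => a i + y i * s] = C * s ^+ d) ->
  forall k, k != d -> (mmap polyC (fun i => (a i)%:P + (y i)%:P * 'X) F)`_k = 0.
Proof.
move=> hF k kd; set P := mmap _ _ _.
have : (P - C *: 'X^d) * 'X = 0.
  apply: poly_vanishing => s; rewrite !hornerE.
  have [->|s0] := eqVneq s 0; first by rewrite mulr0.
  rewrite /P horner_mmap.
  have -> : F.@[fun i => ((a i)%:P + (y i)%:P * 'X).[s]] = F.@[fun i => a i + y i * s].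
    by apply: meval_eq => i; rewrite !hornerE.
  by rewrite hF // subrr mul0r.
move/eqP; rewrite mulf_eq0 polyX_eq0 orbF subr_eq0 => /eqP->.
by rewrite coefZ coefXn (negbTE kd) mulr0.
Qed.

(** The substitution t = 1/s in the homogeneous form F. *)
Lemma line_at_infinity d (F : {mpoly K[3]}) (a y : 'I_3 -> K) c :
  F \is d.-homog -> (forall t, F.@[fun i => t * a i + y i] = c) ->
  forall s, s != 0 -> F.@[fun i => a i + y i * s] = c * s ^+ d.
Proof.
move=> hF hc s s0; rewrite -(hc s^-1) mulrC.
rewrite -(mmap_homog idfun s (fun i => s^-1 * a i + y i) hF).
by apply: meval_eq => i; rewrite mulrDr mulrA divff // mul1r mulrC.
Qed.

Lemma line_gradient d (F : {mpoly K[3]}) (a y : 'I_3 -> K) c : (1 < d)%N ->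
  F \is d.-homog -> (forall t, F.@[fun i => t * a i + y i] = c) ->
  \sum_i F^`M(i).@[a] * y i = 0.
Proof.
move=> d1 hF hc; have h := line_coef_eq0 (line_at_infinity hF hc).
have [_ /=] := mmap_line_coef idfun F a y.
rewrite -/(meval a) => <-; apply: h; by rewrite neq_ltn d1.
Qed.

(** F(a + s y) = c s^d has neither a linear nor a quadratic term in s. The
    absence of the former makes y a multiple of the tangent direction, that of
    the latter contradicts the hypothesis on the flex form unless y = 0. *)
Lemma line_flex d (F : {mpoly K[3]}) (a y : 'I_3 -> K) c : (2 < d)%N ->
  F \is d.-homog -> (forall t, F.@[fun i => t * a i + y i] = c) ->
  y oz = 0 -> F^`M(ox).@[a] != 0 \/ F^`M(oy).@[a] != 0 -> (flex F).@[a] != 0 ->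
  forall i, y i = 0.
Proof.
move=> d2 hF hc yz grad hflex.
have := line_gradient (ltnW d2) hF hc; rewrite sum_ord3 yz mulr0 addr0.
set A := F^`M(ox).@[a] in grad *; set B := F^`M(oy).@[a] in grad *; move=> hL.
pose tau i := (tangent F i).@[a].
have [m hm] : exists m, forall i, y i = m * tau i.
  have tx : tau ox = - B by rewrite /tau /tangent /= mevalN.
  have ty : tau oy = A by rewrite /tau /tangent.
  have tz : tau oz = 0 by rewrite /tau /tangent /= meval0.
  case: grad => n0.
    exists (y oy / A); apply: ord3P; rewrite ?tx ?ty ?tz ?mulr0 ?divfK //.
    apply: (mulfI n0); rewrite mulrCA -[LHS](addrK (B * y oy)) hL.
    by field.
  exists (- y ox / B); apply: ord3P; rewrite ?tx ?ty ?tz ?mulr0 //.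
    by field.
  by apply: (mulfI n0); rewrite -[LHS](addKr (A * y ox)) hL; field.
have [m0 i|m0] := eqVneq m 0; first by rewrite hm m0 mul0r.
exfalso; move/eqP: hflex; apply; rewrite flex_meval.
apply: (@line_coef_eq0 d F a tau (c / m ^+ d)) => [s s0|]; last by rewrite neq_ltn d2.
have := line_at_infinity hF hc (_ : s / m != 0).
rewrite mulf_neq0 ?invr_neq0 // => /(_ erefl).
rewrite exprMn exprVn mulrA mulrAC => <-; apply: meval_eq => i.
by rewrite hm; field.
Qed.

End Lines.

Section Hyperbolicity.
Context (R : realType) (K : closedFieldType) (v : K -> R).
Context (hv : nonarch_absolute_value v) (hK : absv_complete v).
Context (d1 d2 : nat) (d1_gt0 : (0 < d1)%N) (d2_gt0 : (0 < d2)%N).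
Context (hd : (4 <= d1 + d2)%N) (F1 F2 : {mpoly K[3]}).
Context (h1 : F1 \is d1.-homog) (h2 : F2 \is d2.-homog).
Context (nd : generic_pair d1 d2 F1 F2).
Local Notation hu := (absv_ultranorm hv).
Local Notation gn := (gauss_norm v).
Context (a : 'I_3 -> nat -> K) (g : 'I_3 -> K -> K).
Context (hg : forall i z, absv_cvg v (fun n => \sum_(k < n) a i k * z ^+ k) (g i z)).

Definition truncation (n : nat) (i : 'I_3) : {poly K} := \poly_(k < n) a i k.

Lemma truncation_gauss_cauchy i : gauss_cauchy v (truncation^~ i).
Proof. exact: truncation_cauchy (entire_coef hv (hg i)). Qed.

Lemma truncation_cvg i z : absv_cvg v (fun n => (truncation n i).[z]) (g i z).
Proof.
apply: (absv_cvg_eventually hv (N := 0%N) (hg i z)) => n _.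
by rewrite /truncation horner_poly.
Qed.

(** F(g) is an entire function without zeros. *)
Lemma composite_constant (F : {mpoly K[3]}) :
  (forall z, F.@[g^~ z] != 0) ->
  exists c, gauss_cvg v (fun n => mmap polyC (truncation n) F) c%:P /\
            forall z, F.@[g^~ z] = c.
Proof.
move=> hF; have hc := gauss_cauchy_mmap hv F truncation_gauss_cauchy.
have lim z : absv_cvg v (fun n => (mmap polyC (truncation n) F).[z]) F.@[g^~ z].
  rewrite (_ : (fun n => _) = fun n => F.@[fun i => (truncation n i).[z]]).
    by apply: (absv_cvg_meval hv) => i; exact: truncation_cvg.
  by apply/funext => n; rewrite horner_mmap.
have [z|c _ hcv] := zero_free_constant hv hK hc.
  move=> h; have := absv_cvg_unique hv (lim z) h; apply/eqP; exact: hF.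
exists c; split=> // z; apply: (absv_cvg_unique hv (lim z)).
exact: (gauss_cvg_horner hv z hcv).
Qed.

(** Apply [zero_free_constant] to g_i - t. *)
Lemma entire_surjective i j : a i j.+1 != 0 -> forall t, exists z, g i z = t.
Proof.
move=> aij t; apply: contrapT => no.
have hc : gauss_cauchy v (fun n => truncation n i - t%:P).
  rewrite (_ : (fun n => _) = fun n => truncation n i + (fun=> (- t)%:P) n).
    apply: (gauss_cauchyD hv (truncation_gauss_cauchy i)); exact: gauss_cauchy_cst.
  by apply/funext => n; rewrite polyCN.
have [z h|c _ hcv] := zero_free_constant hv hK hc.
  apply: no; exists z; apply/eqP; rewrite -subr_eq0; apply/eqP.
  apply: (absv_cvg_unique hv _ h).
  rewrite (_ : (fun n => _) = fun n => (truncation n i).[z] + (fun=> - t) n).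
    apply: (absv_cvgD hv (truncation_cvg i z)); exact: absv_cvg_cst.
  by apply/funext => n; rewrite hornerD hornerN hornerC.
have va := ultra_gt0 hu aij.
have [N hN] := hcv 1 _ ltr01 va; pose n := (N + j.+2)%N.
have := hN n (leq_addr _ _); rewrite ltNge => /negP; apply.
apply: le_trans (coef_le_gauss_norm hu 1 _ j.+1).
rewrite !coefB !coefC !subr0 coef_poly expr1n mulr1.
by rewrite ifT // /n addnS ltnS leq_addl.
Qed.

(** For each large r, [near_curve_asymptote] gives one of finitely many points.
    A point whose error has a nonzero coefficient in positive degree is
    excluded once r is large, since the Gauss norm of that error grows; this is
    Liouville's argument, and some point must survive. *)
Lemma asymptotic_line : (forall z, F1.@[g^~ z] != 0) -> (forall z, F2.@[g^~ z] != 0) ->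
  (exists i j, a i j.+1 != 0) ->
  exists c, let b := affine_pt c in
  [/\ F1.@[b] = 0, F2.@[b] = 0, (exists j, a oz j.+1 != 0) &
      forall i j, a i j.+1 = b i * a oz j.+1].
Proof.
move=> hF1 hF2 [i0 [j0 a0]].
have [c1 [hc1 _]] := composite_constant hF1; have [c2 [hc2 _]] := composite_constant hF2.
pose c0 := 1 + v c1 + v c2.
have vc1 := ultra_ge0 hu c1; have vc2 := ultra_ge0 hu c2.
have c0_ge0 : 0 <= c0 by rewrite !addr_ge0.
have [l [k [M [k0 hM]]]] := near_curve_asymptote hv d1_gt0 d2_gt0 hd h1 h2 nd c0_ge0.
pose good c := [/\ F1.@[affine_pt c] = 0, F2.@[affine_pt c] = 0 &
  forall i j, a i j.+1 = affine_pt c i * a oz j.+1].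
suff [c [Fc1 Fc2 hc]] : exists c, good c.
  exists c; split=> //; exists j0; apply: contraNneq a0 => h.
  by rewrite hc h mulr0.
apply: contrapT => nogood.
have growth (q : {poly K}) j r : q`_j.+1 != 0 -> 1 <= r -> `|M| / v q`_j.+1 < r -> M < gn r q.
  move=> qj r1 hr; have vq := ultra_gt0 hu qj.
  apply: lt_le_trans (coef_le_gauss_norm hu r q j.+1).
  apply: le_lt_trans (ler_norm M) _; rewrite mulrC -ltr_pdivrMr //.
  apply: lt_le_trans hr _; rewrite exprS ler_peMr ?exprn_ege1 //.
  exact: le_trans ler01 r1.
have [r0 [n0 hr0]] : exists (r0 : R) (n0 : nat), forall c, c \in l -> forall r n,
    r0 <= r -> 1 <= r -> (n0 <= n)%N ->
    F1.@[affine_pt c] = 0 -> F2.@[affine_pt c] = 0 ->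
    ~ forall i, gn r (truncation n i - affine_pt c i *: truncation n oz) <= M.
  elim: l {hM} => [|c l [r0 [n0 IH]]]; first by exists 0, 0%N.
  have [[Fc1 Fc2]|noF] := pselect (F1.@[affine_pt c] = 0 /\ F2.@[affine_pt c] = 0); last first.
    exists r0, n0 => c'; rewrite inE => /orP[/eqP->|]; last exact: IH.
    by move=> r n _ _ _ Fc1 Fc2; case: noF.
  have [i [j hij]] : exists i j, a i j.+1 - affine_pt c i * a oz j.+1 != 0.
    apply: contrapT => no; apply: nogood; exists c; split=> // i j.
    apply/eqP; rewrite -subr_eq0; apply: contrapT => h; apply: no.
    by exists i, j; apply/negP.
  exists (Num.max r0 (`|M| / v (a i j.+1 - affine_pt c i * a oz j.+1) + 1)).
  exists (n0 + j.+2)%N => c'; rewrite inE => /orP[/eqP->|c'l] r n.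
    rewrite ge_max => /andP[_ hr] r1 hn _ _ /(_ i).
    have jn : (j.+1 < n)%N by apply: leq_trans hn; rewrite leq_addl.
    have co : (truncation n i - affine_pt c i *: truncation n oz)`_j.+1 =
        a i j.+1 - affine_pt c i * a oz j.+1.
      by rewrite coefB coefZ !coef_poly jn.
    rewrite leNgt => /negP; apply; apply: (growth _ j) => //; rewrite co //.
    by apply: lt_le_trans hr; rewrite ltrDl.
  rewrite ge_max => /andP[hr _] r1 hn; apply: IH => //.
  exact: leq_trans (leq_addr _ _) hn.
pose rM := `|M| / v (a i0 j0.+1) + 1.
pose r := Num.max (Num.max 1 r0) rM.
have r1 : 1 <= r by rewrite !le_max lexx.
have rr0 : r0 <= r by rewrite !le_max lexx orbT.
have r_gt0 : 0 < r by exact: lt_le_trans ltr01 r1.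
have hgr := gauss_ultranorm hu r_gt0.
have [N1 hN1] := hc1 r 1 r_gt0 ltr01; have [N2 hN2] := hc2 r 1 r_gt0 ltr01.
pose n := (N1 + N2 + n0 + j0.+2)%N.
have [n1 n2 n3 n4] := leq_add4 (leqnn n).
pose X := Num.max (gn r (truncation n ox))
  (Num.max (gn r (truncation n oy)) (gn r (truncation n oz))).
have hX : forall i, gn r (truncation n i) <= X.
  by apply: ord3P; rewrite !le_max lexx ?orbT.
have MX : M <= X.
  apply: le_trans (hX i0); apply: ltW; apply: (growth _ j0) => //.
    by rewrite coef_poly n4.
  rewrite coef_poly n4 /r lt_max; apply/orP; right.
  by rewrite /rM ltrDl.
have nc : near_curve v F1 F2 c0 r (truncation n) X.
  have small F c : gn r (mmap polyC (truncation n) F - c%:P) < 1 -> v c <= c0 ->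
      gn r (mmap polyC (truncation n) F) <= c0.
    move=> hF hc; rewrite -(subrK c%:P (mmap _ _ _)); apply: (ultraD_le hgr).
      by apply: le_trans (ltW hF) _; rewrite /c0 -addrA lerDl addr_ge0.
    by rewrite (gauss_normC hu).
  split=> //.
  - have mm (x y z : R) : [\/ x = Num.max x (Num.max y z), y = Num.max x (Num.max y z)
        | z = Num.max x (Num.max y z)].
      case: (leP y z) => yz; case: leP => xy; by [constructor 1|constructor 2|constructor 3].
    by case: (mm (gn r (truncation n ox)) (gn r (truncation n oy)) (gn r (truncation n oz))) => e;
      [exists ox | exists oy | exists oz].
  - by apply: small (hN1 n n1) _; rewrite /c0; lra.
  - by apply: small (hN2 n n2) _; rewrite /c0; lra.
have [_ [c cl [Fc1 Fc2 hc]]] := hM r (truncation n) X nc MX.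
exact: (hr0 c cl r n rr0 r1 n3 Fc1 Fc2 hc).
Qed.

Lemma entire_affine (c : 'I_3 -> K) : (forall i j, a i j.+1 = c i * a oz j.+1) ->
  forall i z, g i z = c i * g oz z + (a i 0%N - c i * a oz 0%N).
Proof.
move=> hc i z; apply: (absv_cvg_unique hv (truncation_cvg i z)).
apply: (absv_cvg_eventually hv (u := fun n => (fun=> c i) n * (truncation n oz).[z] +
    (fun=> a i 0%N - c i * a oz 0%N) n) (N := 1%N)).
  apply: (absv_cvgD hv); last exact: absv_cvg_cst.
  by apply: (absv_cvgM hv); [exact: absv_cvg_cst | exact: truncation_cvg].
move=> [//|n] _; rewrite /truncation !horner_poly !big_ord_recl !expr0 !mulr1.
rewrite (eq_bigr (fun k : 'I_n => c i * (a oz k.+1 * z ^+ k.+1))).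
  by rewrite -mulr_sumr; ring.
by move=> k _; rewrite !lift0 hc mulrA.
Qed.

Theorem generic_pair_hyperbolic :
  (forall z, F1.@[g^~ z] != 0) -> (forall z, F2.@[g^~ z] != 0) ->
  (forall i z, g i z = g i 0) \/
  exists b : 'I_3 -> K, forall i z, g i z = b i * g oz z.
Proof.
move=> hF1 hF2.
have [nonc|cst] := pselect (exists i j, a i j.+1 != 0); last first.
  left=> i z; have a0 i' j : a i' j.+1 = 0.
    by apply/eqP; apply: contrapT => /negP h; apply: cst; exists i', j.
  have E := @entire_affine (fun=> 0) (fun i' j => etrans (a0 i' j) (esym (mul0r _))) i.
  by rewrite (E z) (E 0) !mul0r.
right; have [c [Fc1 Fc2 [j aj] hc]] := asymptotic_line hF1 hF2 nonc.
set b := affine_pt c in Fc1 Fc2 hc; exists b.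
have gE := entire_affine hc; pose y i := a i 0%N - b i * a oz 0%N.
suff y0 : forall i, y i = 0 by move=> i z; rewrite gE -/(y i) y0 // addr0.
have yz : y oz = 0 by rewrite /y /b /affine_pt /= mul1r subrr.
have [c1 [_ hc1]] := composite_constant hF1; have [c2 [_ hc2]] := composite_constant hF2.
have line F c' : (forall z, F.@[g^~ z] = c') -> forall t, F.@[fun i => t * b i + y i] = c'.
  move=> hF t; have [z' hz] := entire_surjective aj t.
  rewrite -(hF z'); apply: meval_eq => i'; rewrite gE hz; congr (_ + _); exact: mulrC.
have {}hc1 := line _ _ hc1; have {}hc2 := line _ _ hc2.
have := generic_pair_regular nd (erefl : b oz = 1) Fc1 Fc2.
rewrite /degeneracy !mevalM !mulf_eq0 !negb_or => /andP[/andP[hJ hH2] hH1].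
have [d1E|d1N] := eqVneq d1 1%N.
  rewrite d1E eqxx in hH2; apply: (line_flex _ h2 hc2 yz _ hH2).
    by move: hd; rewrite d1E add1n ltnS.
  have [e|n] := eqVneq (F2^`M(ox)).@[b] 0; [right|by left].
  by apply: contraNneq hJ => e'; rewrite /jac mevalB !mevalM e e' !mulr0 subr0.
have [d2E|d2N] := eqVneq d2 1%N.
  rewrite d2E eqxx in hH1; apply: (line_flex _ h1 hc1 yz _ hH1).
    by move: hd; rewrite d2E addn1 ltnS.
  have [e|n] := eqVneq (F1^`M(ox)).@[b] 0; [right|by left].
  by apply: contraNneq hJ => e'; rewrite /jac mevalB !mevalM e e' !mul0r subr0.
have L1 : \sum_i F1^`M(i).@[b] * y i = 0.
  by apply: line_gradient h1 hc1; rewrite ltn_neqAle eq_sym d1N.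
have L2 : \sum_i F2^`M(i).@[b] * y i = 0.
  by apply: line_gradient h2 hc2; rewrite ltn_neqAle eq_sym d2N.
rewrite sum_ord3 yz mulr0 addr0 in L1; rewrite sum_ord3 yz mulr0 addr0 in L2.
move: hJ; rewrite /jac mevalB !mevalM.
set A1 := (F1^`M(ox)).@[b] in L1 *; set B1 := (F1^`M(oy)).@[b] in L1 *.
set A2 := (F2^`M(ox)).@[b] in L2 *; set B2 := (F2^`M(oy)).@[b] in L2 *.
move=> D0; apply: ord3P => //; apply: (mulIf D0); rewrite mul0r.
  have -> : y ox * (A1 * B2 - B1 * A2) =
    B2 * (A1 * y ox + B1 * y oy) - B1 * (A2 * y ox + B2 * y oy) by ring.
  by rewrite L1 L2 !mulr0 subr0.
have -> : y oy * (A1 * B2 - B1 * A2) =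
  A1 * (A2 * y ox + B2 * y oy) - A2 * (A1 * y ox + B1 * y oy) by ring.
by rewrite L1 L2 !mulr0 subr0.
Qed.

End Hyperbolicity.

(** * The universal Macaulay matrix *)

Section Measures.
Context (n1 n2 : nat).
Implicit Types m : 'X_{1..n1 + n2}.

(** The two degrees of a bihomogeneous polynomial, declared as measures so that
    the theory of homogeneous polynomials applies to each of them. *)
Definition mdegl m := (\sum_(i < n1) m (lshift n2 i))%N.
Definition mdegr m := (\sum_(j < n2) m (rshift n1 j))%N.

Lemma mdegl0 : mdegl 0%MM = 0%N.
Proof. by rewrite /mdegl big1 // => i _; rewrite mnm0E. Qed.
Lemma mdeglD m m' : mdegl (m + m')%MM = (mdegl m + mdegl m')%N.
Proof. by rewrite /mdegl -big_split; apply: eq_bigr => i _; rewrite mnmDE. Qed.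
Lemma mdegr0 : mdegr 0%MM = 0%N.
Proof. by rewrite /mdegr big1 // => i _; rewrite mnm0E. Qed.
Lemma mdegrD m m' : mdegr (m + m')%MM = (mdegr m + mdegr m')%N.
Proof. by rewrite /mdegr -big_split; apply: eq_bigr => i _; rewrite mnmDE. Qed.

End Measures.

#[hnf] HB.instance Definition _ n1 n2 :=
  isMeasure.Build (n1 + n2) (@mdegl n1 n2) (@mdegl0 n1 n2) (@mdeglD n1 n2).
#[hnf] HB.instance Definition _ n1 n2 :=
  isMeasure.Build (n1 + n2) (@mdegr n1 n2) (@mdegr0 n1 n2) (@mdegrD n1 n2).

Section Naturality.
Context (S S' : comNzRingType) (f : {rmorphism S -> S'}).
Implicit Types F : {mpoly S[3]}.

Lemma map_mpoly_mderiv F i : map_mpoly f F^`M(i) = (map_mpoly f F)^`M(i).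
Proof.
by apply/mpolyP => m; rewrite mcoeff_map_mpoly !mcoeff_mderiv mcoeff_map_mpoly raddfMn.
Qed.

Lemma map_mpoly_flex F : map_mpoly f (flex F) = flex (map_mpoly f F).
Proof.
rewrite /flex -(coef_map (map_mpoly f)) /tangent_expansion mmap_rmorph mmap_map_mpoly.
congr (nth 0 (polyseq _) 2); apply: eq_mmap => [c|i] /=.
  by rewrite map_polyC /= map_mpolyC.
rewrite rmorphD rmorphM /= !map_polyC map_polyX /= map_mpolyX; congr (_ + _%:P * _).
rewrite /tangent; case: ifP => _; first by rewrite rmorphN /= map_mpoly_mderiv.
by case: ifP => _; rewrite ?rmorph0 // map_mpoly_mderiv.
Qed.

Lemma map_mpoly_degeneracy d1 d2 F1 F2 :
  map_mpoly f (degeneracy d1 d2 F1 F2) =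
  degeneracy d1 d2 (map_mpoly f F1) (map_mpoly f F2).
Proof.
rewrite /degeneracy /jac !rmorphM rmorphB !rmorphM /= !map_mpoly_mderiv.
by congr (_ * _ * _); case: ifP => _; rewrite ?rmorph1 ?map_mpoly_flex.
Qed.

End Naturality.

Section CoefHomog.
Context (K : fieldType) (n : nat) (mf : measure n).
Local Notation S := {mpoly K[n]}.
Implicit Types F P Q : {mpoly S[3]}.

(** P has coefficients in the ring of polynomials in the coefficients of the two
    forms; this is the homogeneity with respect to those. *)
Definition coefhom (e : nat) P : Prop := forall m, P@_m \is e.-homog for mf.

Lemma coefhom0 e : coefhom e 0.
Proof. by move=> m; rewrite mcoeff0 rpred0. Qed.

Lemma coefhomD e P Q : coefhom e P -> coefhom e Q -> coefhom e (P + Q).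
Proof. by move=> hP hQ m; rewrite mcoeffD rpredD. Qed.

Lemma coefhomN e P : coefhom e P -> coefhom e (- P).
Proof. by move=> hP m; rewrite mcoeffN rpredN. Qed.

Lemma coefhomM e e' P Q : coefhom e P -> coefhom e' Q -> coefhom (e + e') (P * Q).
Proof.
by move=> hP hQ m; rewrite mcoeffM; apply: rpred_sum => k _; exact: dhomogM.
Qed.

Lemma coefhomX m : coefhom 0 'X_[m].
Proof. by move=> k; rewrite mcoeffX; case: (_ == _); rewrite ?rpred0 ?dhomog1. Qed.

Lemma coefhom1 : coefhom 0 1.
Proof. by rewrite -mpolyX0; exact: coefhomX. Qed.

Lemma coefhom_mderiv e P i : coefhom e P -> coefhom e P^`M(i).
Proof. by move=> hP m; rewrite mcoeff_mderiv rpredMn. Qed.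

(** The coefficient of s^k in F(x + s tangent) has degree e + k e: each power of
    s carries one factor from the tangent. *)
Lemma coefhom_flex e F : coefhom e F -> coefhom (e + 2 * e) (flex F).
Proof.
move=> hF; pose gr e0 (P : {poly {mpoly S[3]}}) := forall k, coefhom (e0 + k * e) P`_k.
have grM e0 e1 (P Q : {poly {mpoly S[3]}}) : gr e0 P -> gr e1 Q -> gr (e0 + e1)%N (P * Q).
  move=> hP hQ k m; rewrite coefM raddf_sum; apply: rpred_sum => i _ /=.
  have -> : (e0 + e1 + k * e = (e0 + i * e) + (e1 + (k - i) * e))%N.
    by rewrite mulnBl; have := leq_mul (leq_ord i) (leqnn e); lia.
  exact: coefhomM.
have gl i : gr 0%N (('X_i)%:P + (tangent F i)%:P * 'X).
  move=> k; rewrite coefD coefC coefMX coefC; case: k => [|[|k]] /=.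
  - by rewrite addr0; exact: coefhomX.
  - rewrite add0r mul1n add0n /tangent; case: ifP => _.
      by apply: coefhomN; exact: coefhom_mderiv.
    by case: ifP => _; [exact: coefhom_mderiv | exact: coefhom0].
  - by rewrite addr0; exact: coefhom0.
suff h : gr e (tangent_expansion F) by exact: h.
rewrite /tangent_expansion /mmap => k m; rewrite coef_sum raddf_sum.
apply: rpred_sum => m' _ /=.
have hc : gr e (F@_m')%:MP%:P.
  move=> j {}m; rewrite coefC; case: j => [|j] /=; last by rewrite mcoeff0 rpred0.
  rewrite mcoeffC addn0; case: (_ == _); first by rewrite mulr1; exact: hF.
  by rewrite mulr0 rpred0.
have h0 : gr 0%N 1.
  by move=> j; rewrite coefC; case: j => [|j] /=; [exact: coefhom1|exact: coefhom0].
have hm : gr 0%N (mmap1 (fun i => ('X_i)%:P + (tangent F i)%:P * 'X) m').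
  rewrite /mmap1; elim/big_ind: _ => [//|P Q|i _]; first exact: grM.
  elim: (m' i) => [|j IH]; first by rewrite expr0.
  by rewrite exprS; apply: (grM 0%N 0%N).
by have := grM _ _ _ _ hc hm k m; rewrite addn0.
Qed.

Lemma coefhom_degeneracy d1 d2 e1 e2 F1 F2 : coefhom e1 F1 -> coefhom e2 F2 ->
  exists e, coefhom e (degeneracy d1 d2 F1 F2).
Proof.
move=> h1 h2.
have hJ : coefhom (e1 + e2) (jac F1 F2).
  by apply: coefhomD; [|apply: coefhomN]; apply: coefhomM; exact: coefhom_mderiv.
have cond e b P : coefhom e P -> exists e', coefhom e' (if b : bool then P else 1).
  by move=> hP; case: b; [exists e | exists 0%N; exact: coefhom1].
have [e3 h3] := cond _ (d1 == 1%N) _ (coefhom_flex h2).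
have [e4 h4] := cond _ (d2 == 1%N) _ (coefhom_flex h1).
by exists (e1 + e2 + e3 + e4)%N; exact: coefhomM (coefhomM hJ h3) h4.
Qed.

End CoefHomog.

Section Macaulay.
Context (M1 M2 M3 M : nat).

(** The matrix, on monomials of degree M, of (A, B, C) |-> A G1 + B G2 + C G3
    for forms A, B, C of degrees M1, M2, M3. *)
Definition macaulay (S : comNzRingType) (G1 G2 G3 : {mpoly S[3]}) :
    'M[S]_(#|monomials3 M1| + #|monomials3 M2| + #|monomials3 M3|, #|monomials3 M|) :=
  col_mx (col_mx (\matrix_(i, j) ('X_[mon i] * G1)@_(mon j))
                 (\matrix_(i, j) ('X_[mon i] * G2)@_(mon j)))
         (\matrix_(i, j) ('X_[mon i] * G3)@_(mon j)).

Lemma map_macaulay (S S' : comNzRingType) (f : {rmorphism S -> S'}) G1 G2 G3 :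
  map_mx f (macaulay G1 G2 G3) =
  macaulay (map_mpoly f G1) (map_mpoly f G2) (map_mpoly f G3).
Proof.
have h k (G : {mpoly S[3]}) : map_mx f (\matrix_(i < #|monomials3 k|, j < #|monomials3 M|)
    ('X_[mon i] * G)@_(mon j)) =
    \matrix_(i < #|monomials3 k|, j < #|monomials3 M|) ('X_[mon i] * map_mpoly f G)@_(mon j).
  by apply/matrixP => i j; rewrite !mxE -mcoeff_map_mpoly rmorphM /= map_mpolyX.
by rewrite /macaulay !map_col_mx !h.
Qed.

Lemma mul_macaulay (S : comNzRingType) (G1 G2 G3 : {mpoly S[3]})
    (u1 : 'rV[S]_#|monomials3 M1|) (u2 : 'rV[S]_#|monomials3 M2|)
    (u3 : 'rV[S]_#|monomials3 M3|) j :
  (row_mx (row_mx u1 u2) u3 *m macaulay G1 G2 G3) 0 j =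
  ((\sum_i u1 0 i *: 'X_[mon i]) * G1 + (\sum_i u2 0 i *: 'X_[mon i]) * G2 +
   (\sum_i u3 0 i *: 'X_[mon i]) * G3)@_(mon j).
Proof.
have h k (G : {mpoly S[3]}) (u : 'rV[S]_#|monomials3 k|) :
    (u *m (\matrix_(i < #|monomials3 k|, j < #|monomials3 M|)
      ('X_[mon i] * G)@_(mon j))) 0 j = ((\sum_i u 0 i *: 'X_[mon i]) * G)@_(mon j).
  rewrite mxE mulr_suml raddf_sum; apply: eq_bigr => i _ /=.
  by rewrite mxE -scalerAl mcoeffZ.
by rewrite /macaulay !mul_row_col !mxE !mcoeffD -!h !mxE.
Qed.

Lemma homog_span k (S : comNzRingType) (u : 'rV[S]_#|monomials3 k|) :
  \sum_i u 0 i *: 'X_[mon i] \is k.-homog.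
Proof.
apply: rpred_sum => i _; apply: rpredZ; rewrite dhomogX; apply/eqP; exact: mdeg_mon.
Qed.

Lemma macaulay_row_full (K : fieldType) e1 e2 e3 (G1 G2 G3 : {mpoly K[3]}) :
  G1 \is e1.-homog -> G2 \is e2.-homog -> G3 \is e3.-homog ->
  (M1 + e1 = M)%N -> (M2 + e2 = M)%N -> (M3 + e3 = M)%N ->
  row_full (macaulay G1 G2 G3) <->
  forall m : 'X_{1..3}, mdeg m = M -> exists A B C : {mpoly K[3]},
    [/\ A \is M1.-homog, B \is M2.-homog, C \is M3.-homog &
        'X_[m] = A * G1 + B * G2 + C * G3].
Proof.
move=> h1 h2 h3 E1 E2 E3; split.
  move=> /row_fullP[B hB] m hm; have [j hj] := mon_surj hm.
  pose u := row j B; pose u1 := lsubmx (lsubmx u); pose u2 := rsubmx (lsubmx u).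
  pose u3 := rsubmx u.
  exists (\sum_i u1 0 i *: 'X_[mon i]), (\sum_i u2 0 i *: 'X_[mon i]),
    (\sum_i u3 0 i *: 'X_[mon i]); split; try exact: homog_span.
  set P := _ + _ + _.
  have hP : P \is M.-homog.
    apply: rpredD; first apply: rpredD.
    - by rewrite -E1; apply: dhomogM => //; exact: homog_span.
    - by rewrite -E2; apply: dhomogM => //; exact: homog_span.
    - by rewrite -E3; apply: dhomogM => //; exact: homog_span.
  apply/mpolyP => m'; have [hm'|hm'] := eqVneq (mdeg m') M; last first.
    rewrite (dhomog_nemf_coeff hP) // mcoeffX; case: eqP => // e.
    by rewrite -e hm eqxx in hm'.
  have [j' <-] := mon_surj hm'.
  rewrite /P -mul_macaulay !hsubmxK /u -row_mul hB rowE mulmx1 mxE eqxx /=.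
  by rewrite mcoeffX -hj (inj_eq (@mon_inj M)) eq_sym.
move=> hm.
have ex (j : 'I_#|monomials3 M|) : exists u, u *m macaulay G1 G2 G3 = delta_mx 0 j :> 'rV_#|monomials3 M|.
  have [A [B [C [hA hB hC E]]]] := hm _ (mdeg_mon j).
  exists (row_mx (row_mx (\row_i A@_(mon i)) (\row_i B@_(mon i))) (\row_i C@_(mon i))).
  apply/rowP => j'; rewrite mul_macaulay.
  have h k (P : {mpoly K[3]}) : P \is k.-homog ->
      \sum_(i < #|monomials3 k|) (\row_i P@_(mon i)) 0 i *: 'X_[mon i] = P.
    move=> hP; rewrite [RHS](homog_expand hP); apply: eq_bigr => i _; by rewrite mxE.
  by rewrite !h // -E mcoeffX mxE eqxx /= (inj_eq (@mon_inj M)) eq_sym.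
have [u hu] := choice ex.
apply/row_fullP; exists (\matrix_j u j); apply/row_matrixP => j.
by rewrite row_mul rowK hu rowE mulmx1.
Qed.

End Macaulay.

(** A matrix of polynomials whose specialization at a point has full rank keeps
    full rank wherever one fixed maximal minor does not vanish. *)
Lemma full_rank_minor (K : fieldType) n r c (A : 'M[{mpoly K[n]}]_(r, c)) (x0 : 'I_n -> K) :
  row_full (map_mx (meval x0) A) -> exists f : 'I_c -> 'I_r,
  let G := \det (rowsub f A) in
  G.@[x0] != 0 /\ forall x, G.@[x] != 0 -> row_full (map_mx (meval x) A).
Proof.
move=> hf; exists (fullrankfun hf) => G.
have GE x : G.@[x] = \det (rowsub (fullrankfun hf) (map_mx (meval x) A)).
  by rewrite -[LHS](det_map_mx (meval x)); congr (\det _); apply/matrixP => i j; rewrite !mxE.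
split.
  by rewrite GE -unitfE -[_ \is a _]/(_ \in unitmx) -row_full_unit; exact: fullrowsub_full.
move=> x; rewrite GE -unitfE => hu; set B := rowsub _ _ in hu.
have hB : B \in unitmx by [].
apply/row_fullP; exists (invmx B *m rowsub (fullrankfun hf) 1%:M).
by rewrite -mulmxA -rowsubE mulVmx.
Qed.

Lemma det_homog (K : fieldType) n (mf : measure n) c (A : 'M[{mpoly K[n]}]_c) (e : 'I_c -> nat) :
  (forall i j, A i j \is (e i).-homog for mf) -> \det A \is (\sum_i e i).-homog for mf.
Proof.
move=> hA; rewrite /determinant; apply: rpred_sum => s _; rewrite rpredMsign.
by elim/big_rec2: _ => [|i P d _ IH]; [exact: dhomog1 | exact: dhomogM].
Qed.

Definition pair_coefs (S : comNzRingType) (d1 d2 : nat) (F1 F2 : {mpoly S[3]})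
    (k : 'I_(#|monomials3 d1| + #|monomials3 d2|)) : S :=
  match split k with inl i => F1@_(mon i) | inr j => F2@_(mon j) end.
Arguments pair_coefs {S} d1 d2 F1 F2 k.

(** One pair satisfying generic_pair makes it an open condition: the Macaulay
    matrix of the universal pair of forms has full rank at that pair, and the
    minor that witnesses this is bihomogeneous since every row is. *)
Lemma generic_pair_open (K : fieldType) (d1 d2 : nat) (F1 F2 : {mpoly K[3]}) :
  (4 <= d1 + d2)%N -> F1 \is d1.-homog -> F2 \is d2.-homog ->
  generic_pair d1 d2 F1 F2 ->
  exists G : {mpoly K[#|monomials3 d1| + #|monomials3 d2|]},
  [/\ exists a b, bihomogeneous a b G,
      G.@[pair_coefs d1 d2 F1 F2] != 0 &
      forall F1' F2' : {mpoly K[3]}, F1' \is d1.-homog -> F2' \is d2.-homog ->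
      G.@[pair_coefs d1 d2 F1' F2'] != 0 -> generic_pair d1 d2 F1' F2'].
Proof.
move=> hd h1 h2 [N [hN1 hN2 hN hgen]].
pose n1 := #|monomials3 d1|; pose n2 := #|monomials3 d2|.
pose U1 : {mpoly {mpoly K[n1 + n2]}[3]} := \sum_(i < n1) 'X_(lshift n2 i) *: 'X_[mon i].
pose U2 : {mpoly {mpoly K[n1 + n2]}[3]} := \sum_(j < n2) 'X_(rshift n1 j) *: 'X_[mon j].
have ev1 (P Q : {mpoly K[3]}) : P \is d1.-homog ->
    map_mpoly (meval (pair_coefs d1 d2 P Q)) U1 = P.
  move=> hP; rewrite [RHS](homog_expand hP) rmorph_sum; apply: eq_bigr => i _ /=.
  by rewrite map_mpolyZ map_mpolyX /= mevalXU /pair_coefs (unsplitK (inl i)).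
have ev2 (P Q : {mpoly K[3]}) : Q \is d2.-homog ->
    map_mpoly (meval (pair_coefs d1 d2 P Q)) U2 = Q.
  move=> hQ; rewrite [RHS](homog_expand hQ) rmorph_sum; apply: eq_bigr => i _ /=.
  by rewrite map_mpolyZ map_mpolyX /= mevalXU /pair_coefs (unsplitK (inr i)).
pose dg := degeneracy_deg d1 d2.
pose A := macaulay (N.+1 - d1) (N.+1 - d2) (N - dg) N.+1 U1 U2
  ('X_oz * degeneracy d1 d2 U1 U2).
have evA (P Q : {mpoly K[3]}) : P \is d1.-homog -> Q \is d2.-homog ->
    map_mx (meval (pair_coefs d1 d2 P Q)) A =
    macaulay (N.+1 - d1) (N.+1 - d2) (N - dg) N.+1 P Q ('X_oz * degeneracy d1 d2 P Q).
  move=> hP hQ; have e1 := ev1 P Q hP; have e2 := ev2 P Q hQ.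
  have eT : map_mpoly (meval (pair_coefs d1 d2 P Q)) ('X_oz * degeneracy d1 d2 U1 U2) =
      'X_oz * degeneracy d1 d2 P Q.
    have -> : degeneracy d1 d2 P Q =
        map_mpoly (meval (pair_coefs d1 d2 P Q)) (degeneracy d1 d2 U1 U2).
      by rewrite map_mpoly_degeneracy e1 e2.
    by rewrite -(map_mpolyX (meval (pair_coefs d1 d2 P Q))) -rmorphM.
  by rewrite map_macaulay eT e1 e2.
have full (P Q : {mpoly K[3]}) : P \is d1.-homog -> Q \is d2.-homog ->
    row_full (map_mx (meval (pair_coefs d1 d2 P Q)) A) <->
    forall m : 'X_{1..3}, mdeg m = N.+1 -> exists A B C : {mpoly K[3]},
    [/\ A \is (N.+1 - d1).-homog, B \is (N.+1 - d2).-homog,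
        C \is (N - dg).-homog &
        'X_[m] = A * P + B * Q + C * ('X_oz * degeneracy d1 d2 P Q)].
  move=> hP hQ; rewrite (evA P Q hP hQ).
  have hT : 'X_oz * degeneracy d1 d2 P Q \is (1 + dg).-homog.
    apply: dhomogM; last exact: degeneracy_homog.
    by rewrite dhomogX; apply/eqP; exact: mdeg1.
  apply: (macaulay_row_full hP hQ hT).
  - by rewrite subnK // leqW.
  - by rewrite subnK // leqW.
  - by rewrite addnCA subnK // add1n.
have [f [G0 hG]] := full_rank_minor (proj2 (full F1 F2 h1 h2) hgen).
exists (\det (rowsub f A)); split=> //; last first.
  by move=> P Q hP hQ /hG /(full P Q hP hQ) h; exists N.
have grade (mf : measure (n1 + n2)) e1 e2 : coefhom mf e1 U1 -> coefhom mf e2 U2 ->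
    exists e, \det (rowsub f A) \is e.-homog for mf.
  move=> c1 c2; have [e3 c3] := coefhom_degeneracy d1 d2 c1 c2.
  have hrow (i : 'I_(#|monomials3 (N.+1 - d1)| + #|monomials3 (N.+1 - d2)| +
      #|monomials3 (N - dg)|)) : exists e, forall j, A i j \is e.-homog for mf.
    have hX e k (P : {mpoly {mpoly K[n1 + n2]}[3]}) (i' : 'I_#|monomials3 k|) m :
        coefhom mf e P -> ('X_[mon i'] * P)@_m \is e.-homog for mf.
      by move=> hP; have := coefhomM (coefhomX K mf (mon i')) hP m; rewrite add0n.
    rewrite /A /macaulay; case: (split_ordP i) => [i1 ->|i1 ->].
      case: (split_ordP i1) => [i2 ->|i2 ->]; [exists e1|exists e2] => j.
        by rewrite !col_mxEu mxE; exact: hX.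
      by rewrite col_mxEu col_mxEd mxE; exact: hX.
    exists e3 => j; rewrite col_mxEd mxE; apply: hX.
    by have := coefhomM (coefhomX K mf U_(oz)%MM) c3; rewrite add0n.
  have [e he] := choice hrow.
  by exists (\sum_i e (f i))%N; apply: det_homog => i j; rewrite mxE.
have coefU (mf : measure (n1 + n2)) e k (c : 'I_#|monomials3 k| -> 'I_(n1 + n2)) :
    (forall i, mf U_(c i)%MM = e) ->
    coefhom mf e (\sum_i 'X_(c i) *: 'X_[mon i] : {mpoly {mpoly K[n1 + n2]}[3]}).
  move=> hc m; rewrite raddf_sum; apply: rpred_sum => i _ /=.
  rewrite mcoeffZ mcoeffX; case: (_ == _); last by rewrite mulr0 rpred0.
  by rewrite mulr1 dhomogX; apply/eqP; exact: hc.
have ll (i : 'I_n1) : mdegl (U_(lshift n2 i))%MM = 1%N.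
  rewrite /mdegl (bigD1 i) //= mnm1E eqxx big1 // => j ji.
  by rewrite mnm1E eq_lshift eq_sym (negbTE ji).
have lr (i : 'I_n2) : mdegl (U_(rshift n1 i))%MM = 0%N.
  by rewrite /mdegl big1 // => j _; rewrite mnm1E eq_rlshift.
have rl (i : 'I_n1) : mdegr (U_(lshift n2 i))%MM = 0%N.
  by rewrite /mdegr big1 // => j _; rewrite mnm1E eq_lrshift.
have rr (i : 'I_n2) : mdegr (U_(rshift n1 i))%MM = 1%N.
  rewrite /mdegr (bigD1 i) //= mnm1E eqxx big1 // => j ji.
  by rewrite mnm1E eq_rshift eq_sym (negbTE ji).
have [a ha] := grade (@mdegl n1 n2) 1%N 0%N
  (coefU (@mdegl n1 n2) 1%N d1 (lshift n2) ll) (coefU (@mdegl n1 n2) 0%N d2 (@rshift n1 n2) lr).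
have [b hb] := grade (@mdegr n1 n2) 0%N 1%N
  (coefU (@mdegr n1 n2) 0%N d1 (lshift n2) rl) (coefU (@mdegr n1 n2) 1%N d2 (@rshift n1 n2) rr).
exists a, b => m hm; split; [exact: (dhomogP _ _ _ ha) | exact: (dhomogP _ _ _ hb)].
Qed.

(** * A pair in general position *)

Lemma mderivXn (n : nat) (S : comNzRingType) (i j : 'I_n) k :
  ('X_j ^+ k : {mpoly S[n]})^`M(i) = if i == j then k%:R *: 'X_j ^+ k.-1 else 0.
Proof.
rewrite !mpolyXn mderivX mulmnE mnm1E eq_sym.
case: eqP => [<-|_]; last by rewrite mul0n scale0r.
rewrite mul1n; congr (_ *: 'X_[_]); case: k => [|k] /=.
  by apply/mnmP => l; rewrite mnmBE mulmnE mnm1E muln0 sub0n.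
by rewrite mulmS addmC addmK.
Qed.

Section IdealMembership.
Context (A : comNzRingType) (I : A -> Prop).
Context (ID : forall p q, I p -> I q -> I (p + q)) (IM : forall p q, I q -> I (p * q)).

Lemma ideal_power p w k : I (p - w) -> I (w ^+ k) -> I (p ^+ k).
Proof.
move=> hp hw; rewrite -(subrK (w ^+ k) (p ^+ k)) subrXX; apply: ID => //.
by rewrite mulrC; exact: IM.
Qed.

End IdealMembership.

Section GenericPairFromIdeal.
Context (K : fieldType) (d1 d2 : nat) (F1 F2 : {mpoly K[3]}).
Context (hd : (4 <= d1 + d2)%N) (h1 : F1 \is d1.-homog) (h2 : F2 \is d2.-homog).

Definition degeneracy_ideal (P : {mpoly K[3]}) : Prop :=
  exists A B C, P = A * F1 + B * F2 + C * ('X_oz * degeneracy d1 d2 F1 F2).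

Lemma degeneracy_idealD P Q :
  degeneracy_ideal P -> degeneracy_ideal Q -> degeneracy_ideal (P + Q).
Proof.
move=> [A [B [C ->]]] [A' [B' [C' ->]]]; exists (A + A'), (B + B'), (C + C').
by move: (degeneracy _ _ _ _) => T; ring.
Qed.

Lemma degeneracy_idealM P Q : degeneracy_ideal Q -> degeneracy_ideal (P * Q).
Proof.
move=> [A [B [C ->]]]; exists (P * A), (P * B), (P * C).
by move: (degeneracy _ _ _ _) => T; ring.
Qed.

(** The degree is three times the common exponent, so that each monomial
    contains one of the powers; homogeneous components of the cofactors are
    taken to control their degrees. *)
Lemma generic_pair_of_ideal :
  (forall i, exists k, degeneracy_ideal ('X_i ^+ k)) -> generic_pair d1 d2 F1 F2.
Proof.
move=> /choice[kk hkk]; pose k := (\sum_i kk i)%N.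
have {hkk} hk i : degeneracy_ideal ('X_i ^+ k).
  rewrite /k (bigD1 i) //= addnC exprD; apply: degeneracy_idealM; exact: hkk.
pose N := (3 * k + d1 + d2 + degeneracy_deg d1 d2)%N.
have hT : 'X_oz * degeneracy d1 d2 F1 F2 \is (degeneracy_deg d1 d2).+1.-homog.
  rewrite -[(degeneracy_deg d1 d2).+1]add1n; apply: dhomogM; last exact: degeneracy_homog.
  by rewrite dhomogX; apply/eqP; exact: mdeg1.
exists N; split; try by rewrite /N; lia.
move=> m hm.
have [i hi] : exists i, (k <= m i)%N.
  apply: contrapT => no; have lt i : (m i < k)%N.
    by rewrite ltnNge; apply/negP => h; apply: no; exists i.
  have := hm; rewrite mdegE !big_ord_recl big_ord0 /N.
  have := lt ord0; have := lt (lift ord0 ord0); have := lt (lift ord0 (lift ord0 ord0)).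
  by lia.
have [A [B [C E]]] : degeneracy_ideal 'X_[m].
  rewrite -(submK (m := (U_(i) *+ k)%MM) (m' := m)).
    rewrite mpolyXD -mpolyXn; apply: degeneracy_idealM; exact: hk.
  apply/mnm_lepP => j; rewrite mulmnE mnm1E; case: eqP => [<-|_]; last by [].
  by rewrite mul1n.
have hX : ('X_[m] : {mpoly K[3]}) \is N.+1.-homog by rewrite dhomogX; apply/eqP.
exists (pihomog mdeg (N.+1 - d1) A), (pihomog mdeg (N.+1 - d2) B).
exists (pihomog mdeg (N - degeneracy_deg d1 d2) C); split; try exact: pihomogP.
rewrite -(pihomog_dE hX) E !raddfD /= (pihomogM _ h1) ?(pihomogM _ h2) ?(pihomogM _ hT) //;
  rewrite /N; lia.
Qed.

Lemma generic_pair_of_oz k a b Wx Wy : degeneracy_ideal ('X_oz ^+ k) ->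
  degeneracy_ideal ('X_ox ^+ a - 'X_oz * Wx) ->
  degeneracy_ideal ('X_oy ^+ b - 'X_oz * Wy) -> generic_pair d1 d2 F1 F2.
Proof.
move=> hz hx hy; apply: generic_pair_of_ideal; apply: ord3P; last by exists k.
  exists (a * k)%N; rewrite exprM.
  apply: (ideal_power degeneracy_idealD degeneracy_idealM hx).
  by rewrite exprMn mulrC; exact: degeneracy_idealM.
exists (b * k)%N; rewrite exprM.
apply: (ideal_power degeneracy_idealD degeneracy_idealM hy).
by rewrite exprMn mulrC; exact: degeneracy_idealM.
Qed.

End GenericPairFromIdeal.

Section Example.
Context (K : closedFieldType).
Local Notation P3 := {mpoly K[3]}.

(** A binary form with d distinct zeros away from X_oz = 0 in every
    characteristic: x^d - z^d has this property only if the characteristic does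
    not divide d. *)
Definition binary_form (d : nat) (i : 'I_3) : P3 :=
  'X_i ^+ d - (if d%:R == 0 :> K then 'X_i * 'X_oz ^+ d.-1 else 'X_oz ^+ d).

Definition example_form (d d' : nat) (i j : 'I_3) : P3 :=
  binary_form d i + (if d' == 1%N then ('X_j - 'X_oz) ^+ 2 * 'X_oz ^+ (d - 2) else 0).

Let hX k (i : 'I_3) : ('X_i ^+ k : P3) \is k.-homog.
Proof.
rewrite mpolyXn dhomogX; apply/eqP; change (mdeg (U_(i) *+ k)%MM = k).
by rewrite mdegMn mdeg1 mul1n.
Qed.

Let hX1 (i : 'I_3) : ('X_i : P3) \is 1.-homog.
Proof. exact: (hX 1). Qed.

Lemma binary_form_homog d i : (0 < d)%N -> binary_form d i \is d.-homog.
Proof.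
move=> d0; apply: rpredB; first exact: hX.
case: ifP => _; last exact: hX.
by have := dhomogM (hX1 i) (hX d.-1 oz); rewrite add1n prednK.
Qed.

Lemma example_form_homog d d' i j : (0 < d)%N -> (d' = 1%N -> (2 < d)%N) ->
  example_form d d' i j \is d.-homog.
Proof.
move=> d0 hd'; apply: rpredD; first exact: binary_form_homog.
case: eqP => [/hd' d2|_]; last exact: rpred0.
have hw : ('X_j - 'X_oz : P3) \is 1.-homog by exact: rpredB.
by have := dhomogM (dhomogMn 2 hw) (hX (d - 2) oz); rewrite mul1n subnKC // ltnW.
Qed.

Lemma binary_form_mderiv_other d i l : l != i -> l != oz ->
  (binary_form d i)^`M(l) = 0.
Proof.
move=> li lz; rewrite /binary_form mderivB mderivXn (negbTE li) sub0r.
case: ifP => _; last by rewrite mderivXn (negbTE lz) oppr0.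
by rewrite mderivM -['X_i]expr1 !mderivXn (negbTE li) (negbTE lz) mul0r mulr0 addr0 oppr0.
Qed.

Lemma binary_form_separable d i : (0 < d)%N -> i != oz ->
  exists U V : P3, 'X_oz ^+ d = U * binary_form d i + V * (binary_form d i)^`M(i).
Proof.
move=> d0 iz; rewrite /binary_form mderivB mderivXn eqxx.
case: eqP => [dE|/eqP dE].
  exists 0, (- 'X_oz); rewrite dE scale0r sub0r mderivM mderivXn (negbTE iz) mulr0 addr0.
  have -> : ('X_i : P3)^`M(i) = 1 by rewrite -['X_i]expr1 mderivXn eqxx expr0 scale1r.
  rewrite mul1r mul0r add0r.
  by rewrite mulrNN -exprS prednK.
exists (-1), ((d%:R^-1)%:MP * 'X_i); rewrite mderivXn (negbTE iz) subr0.
rewrite -mul_mpolyC mulrACA -mpolyCM mulVf // mul1r -exprS prednK //; ring.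
Qed.

Lemma binary_form_at_infinity d i : (0 < d)%N ->
  exists W : P3, binary_form d i = 'X_i ^+ d - 'X_oz * W.
Proof.
move=> d0; rewrite /binary_form; case: eqP => dE.
  case: d d0 dE => [//|[|d]] _ dE; first by move/eqP: dE; rewrite oner_eq0.
  by exists ('X_i * 'X_oz ^+ d); rewrite /= mulrCA -exprS.
by exists ('X_oz ^+ d.-1); rewrite -exprS prednK.
Qed.

Lemma example_form_mderiv d d' i j : i != j -> i != oz ->
  (example_form d d' i j)^`M(i) = (binary_form d i)^`M(i).
Proof.
move=> ij iz; rewrite /example_form mderivD; case: ifP => _; last by rewrite mderiv0 addr0.
have e0 l : i != l -> ('X_l : P3)^`M(i) = 0.
  by move=> il; rewrite -['X_l]expr1 mderivXn (negbTE il).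
rewrite mderivM mderivXn (negbTE iz) mulr0 expr2 mderivM mderivB !e0 //.
by rewrite subrr !(mulr0, mul0r, addr0).
Qed.

Lemma example_form_mderiv_dvd d i j : i != j -> j != oz ->
  exists U, (example_form d 1 i j)^`M(j) = ('X_j - 'X_oz) * U.
Proof.
move=> ij jz; rewrite /example_form /= mderivD binary_form_mderiv_other // 1?eq_sym //.
exists (('X_j - 'X_oz)^`M(j) * 'X_oz ^+ (d - 2) *+ 2).
by rewrite mderivM mderivXn (negbTE jz) mulr0 expr2 mderivM; ring.
Qed.

(** Expanding (X_j - X_oz)^2 contributes t_j^2; the other terms come with a
    factor t_i, which is divisible by X_j - X_oz. *)
Lemma example_form_flex d i j (t : 'I_3 -> P3) U : t oz = 0 -> t i = ('X_j - 'X_oz) * U ->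
  exists W, (mmap (polyC \o @mpolyC 3 K) (fun l => ('X_l)%:P + (t l)%:P * 'X)
               (example_form d 1 i j))`_2 =
            t j ^+ 2 * 'X_oz ^+ (d - 2) + ('X_j - 'X_oz) * W.
Proof.
move=> tz ti.
pose E0 : {rmorphism P3 -> {poly P3}} :=
  mmap (polyC \o @mpolyC 3 K) (fun l => ('X_l)%:P + (t l)%:P * 'X).
have [E [EE EX]] : exists E : {rmorphism P3 -> {poly P3}}, E0 = E /\
    forall l, E 'X_l = ('X_l)%:P + (t l)%:P * 'X.
  by exists E0; split=> // l; rewrite /E0 /= mmapX mmap1U.
rewrite -[mmap _ _ _]/(E0 _) {}EE {E0}.
have Ez : E 'X_oz = ('X_oz)%:P by rewrite EX tz mul0r addr0.
have Ezk k : E ('X_oz ^+ k) = ('X_oz ^+ k)%:P by rewrite rmorphXn  Ez rmorphXn.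
have c2 : (E (('X_j - 'X_oz) ^+ 2 * 'X_oz ^+ (d - 2)))`_2 = t j ^+ 2 * 'X_oz ^+ (d - 2).
  rewrite rmorphM rmorphXn rmorphB  Ezk EX Ez coefMC; congr (_ * _).
  have -> : ('X_j)%:P + (t j)%:P * 'X - ('X_oz)%:P =
    ('X_j - 'X_oz)%:P + (t j)%:P * 'X :> {poly P3} by rewrite polyCB; ring.
  move: ('X_j - 'X_oz) => w.
  have -> : (w%:P + (t j)%:P * 'X) ^+ 2 =
    (w ^+ 2)%:P + (w * t j *+ 2)%:P * 'X + (t j ^+ 2)%:P * 'X^2 :> {poly P3}.
    by rewrite polyCMn !polyCM; ring.
  by rewrite !coefD coefC coefMX coefC coefMXn coefC /= !add0r.
have [Q hQ] : exists Q : {poly P3}, E ('X_i ^+ d) = ('X_i ^+ d)%:P + (t i)%:P * (Q * 'X).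
  have := subrXX (E 'X_i) ('X_i)%:P d; set Q := \sum_(_ < d) _ => e; exists Q.
  rewrite !rmorphXn -(subrK (('X_i)%:P ^+ d) (E 'X_i ^+ d)) e EX /=.
  by move: Q {e} => Q; ring.
have [W hW] : exists W, (E (binary_form d i))`_2 = ('X_j - 'X_oz) * W.
  exists (U * Q`_1); rewrite /binary_form rmorphB  hQ coefB coefD coefC add0r.
  rewrite coefCM coefMX /= ti mulrA -[RHS]subr0; congr (_ - _); case: ifP => _.
    by rewrite rmorphM  Ezk EX coefMC coefD coefC coefMX coefC /= add0r mul0r.
  by rewrite Ezk coefC.
exists W; by rewrite /example_form /= rmorphD  coefD c2 hW addrC.
Qed.

(** Degrees 1 and d. Modulo the linear form X_j - X_oz one has F = q and
    flex F = q_i^2 X_oz^(d-2), where q is the binary form and q_i its derivative: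
    both conditions reduce to the separability of q. The square added to q in
    [example_form] is what makes the flex form nonzero. *)
Lemma example_tangent_ideal (I : P3 -> Prop) d d' i j : d' = 1%N ->
  (forall p q, I p -> I q -> I (p + q)) -> (forall p q, I q -> I (p * q)) ->
  (2 < d)%N -> i != j -> i != oz -> j != oz ->
  let F := example_form d d' i j in
  tangent F j ^+ 2 = F^`M(i) ^+ 2 -> (tangent F i = F^`M(j) \/ tangent F i = - F^`M(j)) ->
  I ('X_j - 'X_oz) -> I F -> I ('X_oz * (F^`M(i) * flex F)) ->
  (exists k, I ('X_oz ^+ k)) /\ (exists W, I ('X_i ^+ d - 'X_oz * W)).
Proof.
move=> -> ID IM d2 ij iz jz F tj ti Iw IF IT.
have d0 : (0 < d)%N by exact: leq_trans d2.
have [U0 hU0] := example_form_mderiv_dvd d ij jz.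
have [U hU] : exists U, tangent F i = ('X_j - 'X_oz) * U.
  by case: ti => ->; [exists U0 | exists (- U0); rewrite mulrN -hU0].
have [W hW] := example_form_flex (t := tangent F) d erefl hU.
rewrite -/F -/(tangent_expansion F) -/(flex F) tj in hW.
rewrite hW [F^`M(i)]example_form_mderiv // in IT.
set q := binary_form d i in IT; set w := 'X_j - 'X_oz in Iw IT *.
have Iq : I q.
  have -> : q = F + (- (w * 'X_oz ^+ (d - 2))) * w by rewrite /F /example_form /= -/q -/w; ring.
  by apply: (ID) => //; exact: IM.
have Iqz : I (q^`M(i) ^+ 3 * 'X_oz ^+ (d - 2).+1).
  have -> : q^`M(i) ^+ 3 * 'X_oz ^+ (d - 2).+1 =
     'X_oz * (q^`M(i) * (q^`M(i) ^+ 2 * 'X_oz ^+ (d - 2) + w * W)) +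
     (- ('X_oz * q^`M(i) * W)) * w.
    by rewrite ['X_oz ^+ (d - 2).+1]exprS; ring.
  by apply: (ID) => //; exact: IM.
split; last first.
  by have [W' hW'] := binary_form_at_infinity i d0; exists W'; rewrite -hW'.
have [A [B hAB]] := binary_form_separable d0 iz.
exists (d * 3 + (d - 2).+1)%N; rewrite exprD exprM hAB -/q.
have -> : (A * q + B * q^`M(i)) ^+ 3 * 'X_oz ^+ (d - 2).+1 =
  ('X_oz ^+ (d - 2).+1 * (A ^+ 3 * q ^+ 2 + 3%:R * A ^+ 2 * q * (B * q^`M(i)) +
     3%:R * A * (B * q^`M(i)) ^+ 2)) * q +
  B ^+ 3 * (q^`M(i) ^+ 3 * 'X_oz ^+ (d - 2).+1).
  by move: ('X_oz ^+ _) => z; ring.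
by apply: (ID); exact: IM.
Qed.

Lemma example_form_neq0 d d' i j : (0 < d)%N -> i != j -> i != oz -> (d' = 1%N -> (2 < d)%N) ->
  example_form d d' i j != 0.
Proof.
move=> d0 ij iz hd'; apply/eqP => /(congr1 (meval (fun l => (l == i)%:R : K))).
have [W hW] := binary_form_at_infinity i d0.
have ezi : (oz == i) = false by rewrite eq_sym (negbTE iz).
rewrite meval0 /example_form mevalD hW mevalB mevalM rmorphXn /= !mevalXU eqxx ezi.
rewrite expr1n mul0r subr0.
case: eqP => [/hd' d2|_]; last by rewrite meval0 addr0 => /eqP; rewrite oner_eq0.
rewrite mevalM rmorphXn /= mevalB !mevalXU ezi eq_sym (negbTE ij) subrr expr2 mul0r mul0r addr0.
by move/eqP; rewrite oner_eq0.
Qed.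

(** For d1, d2 >= 2 the two curves are unions of lines x = c z and y = c z. Their
    intersection is transversal by separability of the binary forms. *)
Lemma generic_pair_exists d1 d2 : (0 < d1)%N -> (0 < d2)%N -> (4 <= d1 + d2)%N ->
  exists F1 F2 : P3, [/\ F1 \is d1.-homog, F2 \is d2.-homog, F1 != 0, F2 != 0 &
    generic_pair d1 d2 F1 F2].
Proof.
move=> d1_gt0 d2_gt0 hd.
have big1 : d2 = 1%N -> (2 < d1)%N by move=> e; move: hd; rewrite e addn1.
have big2 : d1 = 1%N -> (2 < d2)%N by move=> e; move: hd; rewrite e add1n.
exists (example_form d1 d2 ox oy), (example_form d2 d1 oy ox).
set F1 := example_form d1 _ _ _; set F2 := example_form d2 _ _ _.
have h1 : F1 \is d1.-homog by exact: example_form_homog.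
have h2 : F2 \is d2.-homog by exact: example_form_homog.
split=> //; [exact: example_form_neq0 | exact: example_form_neq0 |].
pose I := degeneracy_ideal d1 d2 F1 F2.
have ID : forall p q, I p -> I q -> I (p + q) by exact: degeneracy_idealD.
have IM : forall p q, I q -> I (p * q) by exact: degeneracy_idealM.
have I1 : I F1 by exists 1, 0, 0; rewrite !mul0r mul1r !addr0.
have I2 : I F2 by exists 0, 1, 0; rewrite !mul0r mul1r addr0 add0r.
have IT : I ('X_oz * degeneracy d1 d2 F1 F2).
  by exists 0, 0, 1; rewrite !mul0r mul1r !add0r.
have linear d d' (i j l : 'I_3) : d = 1%N -> d' <> 1%N -> (l == oz) = false ->
    example_form d d' i j = 'X_i - 'X_oz /\
    (example_form d d' i j)^`M(l) = (l == i)%:R.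
  move=> -> d'1 lz; have -> : example_form 1 d' i j = 'X_i - 'X_oz.
    rewrite /example_form /binary_form oner_eq0 !expr1.
    by case: eqP => // _; rewrite addr0.
  split=> //; rewrite mderivB -['X_i]expr1 -['X_oz]expr1 !mderivXn lz subr0.
  by case: eqP => // _; rewrite expr0 scale1r.
have [d1E|d1N] := eqVneq d1 1%N.
  have d21 : d2 <> 1%N by move=> e; have := big2 d1E; rewrite e.
  have [F1E F1x] := linear d1 d2 ox oy ox d1E d21 erefl.
  have [_ F1y] := linear d1 d2 ox oy oy d1E d21 erefl.
  rewrite -/F1 in F1E F1x F1y.
  have [|||||[k hk] [W hW]] :=
    @example_tangent_ideal I d2 d1 oy ox d1E ID IM (big2 d1E) isT isT isT.
  - by rewrite {1}/tangent /= sqrrN.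
  - by left; rewrite /tangent.
  - by rewrite -F1E.
  - by [].
  - move: IT; rewrite /degeneracy (introT eqP d1E) (introF eqP d21) mulr1 /jac F1x F1y.
    by rewrite mul1r mul0r subr0.
  apply: (generic_pair_of_oz hd h1 h2 (Wx := 1) (a := 1%N) hk _ hW).
  by rewrite expr1 mulr1 -F1E.
have [d2E|d2N] := eqVneq d2 1%N.
  have d11 : d1 <> 1%N by move/eqP: d1N.
  have [F2E F2y] := linear d2 d1 oy ox oy d2E d11 erefl.
  have [_ F2x] := linear d2 d1 oy ox ox d2E d11 erefl.
  rewrite -/F2 in F2E F2x F2y.
  have [|||||[k hk] [W hW]] :=
    @example_tangent_ideal I d1 d2 ox oy d2E ID IM (big1 d2E) isT isT isT.
  - by rewrite {1}/tangent.
  - by right; rewrite /tangent.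
  - by rewrite -F2E.
  - by [].
  - move: IT; rewrite /degeneracy (introT eqP d2E) (introF eqP d11) mulr1 /jac F2x F2y.
    by rewrite mulr1 mulr0 subr0.
  apply: (generic_pair_of_oz hd h1 h2 (Wy := 1) (b := 1%N) hk hW).
  by rewrite expr1 mulr1 -F2E.
have F1E : F1 = binary_form d1 ox by rewrite /F1 /example_form (negbTE d2N) addr0.
have F2E : F2 = binary_form d2 oy by rewrite /F2 /example_form (negbTE d1N) addr0.
have [Wx hWx] := binary_form_at_infinity ox d1_gt0.
have [Wy hWy] := binary_form_at_infinity oy d2_gt0.
have [A1 [B1 E1]] := binary_form_separable d1_gt0 (erefl : ox != oz).
have [A2 [B2 E2]] := binary_form_separable d2_gt0 (erefl : oy != oz).
rewrite -F1E in hWx E1; rewrite -F2E in hWy E2.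
apply: (generic_pair_of_oz hd h1 h2 (k := (d1 + d2).+1) (a := d1) (b := d2)
  (Wx := Wx) (Wy := Wy)); last 2 first.
- by rewrite -hWx.
- by rewrite -hWy.
have F1y : F1^`M(oy) = 0 by rewrite F1E binary_form_mderiv_other.
rewrite exprS exprD E1 E2.
move: IT; rewrite /degeneracy (negbTE d1N) (negbTE d2N) !mulr1 /jac F1y mul0r subr0 => IT.
have -> : 'X_oz * ((A1 * F1 + B1 * F1^`M(ox)) * (A2 * F2 + B2 * F2^`M(oy))) =
  ('X_oz * A1 * (A2 * F2 + B2 * F2^`M(oy))) * F1 + ('X_oz * B1 * F1^`M(ox) * A2) * F2 +
  (B1 * B2) * ('X_oz * (F1^`M(ox) * F2^`M(oy))).
  by move: F1^`M(ox) F2^`M(oy) => x y; ring.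
by apply: (ID); [apply: (ID) |]; exact: IM.
Qed.

End Example.

(** * Hyperbolicity of generic complements *)

Lemma proj_generator (K : fieldType) (V : vectType K) (L : proj V) (u w : V) :
  u \in sval L -> u != 0 -> w \in sval L -> exists c, w = c *: u.
Proof.
move=> uL u0 wL.
have /eqP dL := svalP L.
have E : <[u]>%VS = sval L.
  by apply/eqP; rewrite eqEdim -memvE uL dim_vline u0 dL.
by move: wL; rewrite -E => /vlineP[c ->]; exists c.
Qed.

Lemma vline_scale (K : fieldType) (V : vectType K) (k : K) (u : V) :
  k != 0 -> <[k *: u]>%VS = <[u]>%VS.
Proof.
move=> k0; apply/vspaceP => x; apply/vlineP/vlineP => -[c ->].
  by exists (c * k); rewrite scalerA.
by exists (c / k); rewrite scalerA divfK.
Qed.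

Lemma curve_form_neq0 (K : fieldType) (d : nat) (D : curve K d) (F : dhomog 3 K d)
    (p : P2 K) (u : 'rV[K]_3) :
  F \in sval D -> F != 0 -> sval p = <[u]>%VS -> ~ curve_points D p ->
  (val F).@[u 0] != 0.
Proof.
move=> FD F0 pu; apply: contra_notN => /eqP Fu _ x [G GD ->]; rewrite pu => /vlineP[k ->].
have [c ->] := proj_generator FD F0 GD.
rewrite [val _]/(c *: val F) mevalZ.
have -> : (val F).@[(k *: u) 0] = (val F).@[fun i => k * u 0 i].
  by apply: meval_eq => i; rewrite mxE.
rewrite -[X in _ * X]/(mmap idfun _ _) (mmap_homog idfun k (u 0) (dhomog_is_dhomog F)).
by rewrite -[mmap _ _ _]/((val F).@[u 0]) Fu !mulr0.
Qed.

Lemma form_line (K : fieldType) (d : nat) (F : {mpoly K[3]}) :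
  F \is d.-homog -> F != 0 -> exists (D : curve K d) (G : dhomog 3 K d),
  [/\ G \in sval D, G != 0 & val G = F].
Proof.
move=> hF F0; pose G := DHomog hF.
have G0 : G != 0 by apply: contraNneq F0 => e; rewrite -[F]/(val G) e.
have dG : \dim <[G]> == 1%N by rewrite dim_vline G0.
by exists (exist _ <[G]>%VS dG), G; split=> //; exact: memv_line.
Qed.

Theorem corollary5 (R : realType) (K : closedFieldType) (v : K -> R)
    (hv : nonarch_absolute_value v) (hK : absv_complete v)
    (d1 d2 : nat) (hd1 : (1 <= d1)%N) (hd2 : (1 <= d2)%N)
    (hd : (4 <= d1 + d2)%N) :
  holds_for_generic_curves (fun (D1 : curve K d1) (D2 : curve K d2) =>
    curve_forms D1 <> curve_forms D2 ->
    K_hyperbolic v (~` (curve_points D1 `|` curve_points D2))).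
Proof.
have [E1 [E2 [hE1 hE2 nE1 nE2 gE]]] := generic_pair_exists K hd1 hd2 hd.
have [G [[a [b hG]] G0 Gopen]] := generic_pair_open hd hE1 hE2 gE.
pose Z : set (curve K d1 * curve K d2) := [set D : curve K d1 * curve K d2 |
  forall (F1 : dhomog 3 K d1) (F2 : dhomog 3 K d2),
  F1 \in sval D.1 -> F1 != 0 -> F2 \in sval D.2 -> F2 != 0 ->
  G.@[pair_coefs d1 d2 (val F1) (val F2)] = 0].
exists (~` Z); split.
- rewrite /zariski_open setCK; exists [set G]; split=> [_ ->|D1 D2].
    by exists a, b.
  split=> [h _ F1 F2 ->|h F1 F2]; first exact: h.
  exact: (h G F1 F2 erefl).
- have [D1 [F1 [m1 n1 e1]]] := form_line hE1 nE1.
  have [D2 [F2 [m2 n2 e2]]] := form_line hE2 nE2.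
  exists (D1, D2) => /(_ F1 F2 m1 n1 m2 n2).
  by rewrite e1 e2; apply/eqP.
move=> D1 D2 nZ _ f [g [hg g0 fg]] fY.
have [F1 [F2 [m1 n1 m2 n2 GF]]] : exists (F1 : dhomog 3 K d1) (F2 : dhomog 3 K d2), [/\ F1 \in sval D1, F1 != 0,
    F2 \in sval D2, F2 != 0 & G.@[pair_coefs d1 d2 (val F1) (val F2)] != 0].
  apply: contrapT => no; apply: nZ => F1 F2 m1 n1 m2 n2; apply/eqP.
  by apply: contrapT => /negP h; apply: no; exists F1, F2.
have gF := Gopen _ _ (dhomog_is_dhomog F1) (dhomog_is_dhomog F2) GF.
have [c hc] := choice hg.
have nonzero d (D : curve K d) (F : dhomog 3 K d) : F \in sval D -> F != 0 ->
    (forall z, ~ curve_points D (f z)) -> forall z, (val F).@[g^~ z] != 0.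
  move=> FD F0 hD z; have := curve_form_neq0 FD F0 (fg z) (hD z).
  by rewrite (@meval_eq _ _ _ (g^~ z)) // => i; rewrite mxE.
have nz1 := nonzero _ _ _ m1 n1 (fun z h => fY z (or_introl h)).
have nz2 := nonzero _ _ _ m2 n2 (fun z h => fY z (or_intror h)).
have [cst|[y hy]] := generic_pair_hyperbolic hv hK hd1 hd2 hd (dhomog_is_dhomog F1)
  (dhomog_is_dhomog F2) gF hc nz1 nz2.
  exists (f 0) => z; apply: val_inj; rewrite [LHS]fg [RHS]fg; congr <[_]>%VS.
  by apply/rowP => i; rewrite !mxE cst.
have line z : sval (f z) = <[\row_i y i]>%VS.
  have gz : g oz z != 0.
    by have [i] := g0 z; rewrite hy; apply: contraNneq => ->; rewrite mulr0.
  rewrite fg -[RHS](vline_scale _ gz); congr <[_]>%VS.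
  by apply/rowP => i; rewrite !mxE (hy i z) mulrC.
by exists (f 0) => z; apply: val_inj; rewrite [LHS]line [RHS]line.
Qed.
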